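(* Let $\kappa,T,M>0$ be real numbers. There is a constant $K$, depending only on $T$, $M$ and $\kappa$, such that the following holds. Let $\mathcal{P}$ and $(\mathcal{L}_p)_{p\in\mathcal{P}}$ be sieve data satisfying $\lambda(p)\le Mp^{1/4}$ for all $p\in\mathcal{P}$ and $V(y)\le T\log^{\kappa}y$ for all $y\ge 2$. Let $N$ and $z$ be positive real numbers with $1\le z\le N^{1/4}$, let $\mathcal{S}(N)=\mathcal{S}(N,\mathcal{P},z)$, let $\delta>0$, and let $\mathcal{B}$ be a non-empty $\delta$-well spaced subset of $\mathbb{R}/\mathbb{Z}$. Then for any sequence of complex numbers $(a_n)_{n\le N}$, $$\sum_{b\in\mathcal{B}}\left|\sum_{n\in\mathcal{S}(N)}a_n e(nb)\right|^2\le K\,\frac{N+\delta^{-1}}{G(z)}\,\log^{\kappa}(2|\mathcal{B}|)\sum_{n\in\mathcal{S}(N)}|a_n|^2.$$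
   Context: Notation: $e(x)=e^{2\pi i x}$. Sieve data: $\mathcal{P}$ is a non-empty set of primes, and for each $p\in\mathcal{P}$, $\mathcal{L}_p$ is a non-empty proper subset of $\mathbb{Z}/p\mathbb{Z}$ with cardinality $\lambda(p)$, so $0<\lambda(p)<p$. For $y\ge 2$, $V(y)=\prod_{p<y,\ p\in\mathcal{P}}\left(1-\frac{\lambda(p)}{p}\right)^{-1}$. Let $h$ be the non-negative multiplicative function supported on squarefree positive integers with $h(p)=\frac{\lambda(p)}{p-\lambda(p)}$ for $p\in\mathcal{P}$ and $h(p)=0$ for primes $p\notin\mathcal{P}$. For real $y\ge 1$, $G(y)=\sum_{m\le y}h(m)$, the sum over positive integers $m\leq y$. The sifted set is $$\mathcal{S}(N)=\mathcal{S}(N,\mathcal{P},z)=\{1\le n\le N:\ n \bmod p\notin\mathcal{L}_p \text{ for every } p\in\mathcal{P} \text{ with } p<z\},$$ where $n$ runs over integers. For $x\in\mathbb{R}/\mathbb{Z}$, $\|x\|=\min_{k\in\mathbb{Z}}|x+k|$ is the distance to the nearest integer. A finite set $\mathcal{B}\subseteq\mathbb{R}/\mathbb{Z}$ is $\delta$-well spaced if $\|x-x'\|\ge\delta$ for all distinct $x,x'\in\mathcal{B}$. *)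

(* Defs.v *)
From HB Require Import structures.
From mathcomp Require Import all_boot all_order all_algebra finmap.
From mathcomp Require Import generic_quotient ring_quotient.
From mathcomp Require Import all_classical all_reals all_analysis complex.

Set Implicit Arguments.
Unset Strict Implicit.
Unset Printing Implicit Defensive.

Import Order.TTheory GRing.Theory Num.Theory.
Import numFieldNormedType.Exports.

Local Open Scope classical_set_scope.
Local Open Scope ring_scope.
Local Open Scope quotient_scope.
Local Open Scope complex_scope.

(* R/Z, with the group structure of the quotient: [Num.int_num_subdef] is the
   predicate underlying [Num.int]. *)
Definition circle (R : realType) :=
  Quotient.quot (GRing.ZmodClosed.clone R (@Num.int_num_subdef R) _).
HB.instance Definition _ (R : realType) := GRing.Zmodule.on (circle R).
HB.instance Definition _ (R : realType) := Quotient.on (circle R).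

(* The next two functions are computed on a representative, whose choice does
   not matter: see [circle_norm_pi] and [circle_e_pi]. *)
Definition circle_norm (R : realType) (x : circle R) : R :=
  inf [set `|repr x + k%:~R| | k in [set: int]].

Definition circle_e (R : realType) (x : circle R) : R[i] :=
  cos (2 * pi * repr x) +i* sin (2 * pi * repr x).

Lemma circle_repr_pi (R : realType) (r : R) :
  exists k : int, repr (\pi_(circle R) r) = r + k%:~R.
Proof.
have /eqP : \pi_(circle R) (repr (\pi_(circle R) r)) = \pi_(circle R) r.
  by rewrite reprK.
rewrite -Quotient.idealrBE => /intrP[k e]; exists k.
by rewrite -e addrC subrK.
Qed.

Lemma circle_norm_pi (R : realType) (r : R) :
  circle_norm (\pi_(circle R) r) = inf [set `|r + k%:~R| | k in [set: int]].
Proof.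
rewrite /circle_norm; have [k ->] := circle_repr_pi r; congr inf.
apply/seteqP; split=> _ [j _ <-].
  by exists (k + j) => //; rewrite intrD addrA.
exists (j - k) => //; congr `| _ |.
by rewrite intrD rmorphN /= -addrA (addrCA k%:~R) subrr addr0.
Qed.

Lemma circle_e_pi (R : realType) (r : R) :
  circle_e (\pi_(circle R) r) = cos (2 * pi * r) +i* sin (2 * pi * r).
Proof.
rewrite /circle_e; have [k ->] := circle_repr_pi r.
have e2 : 2 * pi = pi *+ 2 :> R by rewrite mulr_natl.
have per (f : R -> R) : periodic f (pi *+ 2) ->
    f (2 * pi * (r + k%:~R)) = f (2 * pi * r).
  move=> fp; rewrite mulrDr e2; case: k => n.
    by rewrite -pmulrn mulr_natr periodicn.
  rewrite NegzE rmorphN /= mulrN -pmulrn mulr_natr.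
  by rewrite -[LHS](periodicn fp n.+1) subrK.
by rewrite (per _ (@cosD2pi R)) (per _ (@sinD2pi R)).
Qed.

Definition well_spaced (R : realType) (delta : R) (B : {fset circle R}) :=
  forall x x' : circle R, x \in B -> x' \in B -> x != x' ->
    delta <= circle_norm (x - x').

(* Only the values [L p] for p in P matter; for such p, p is prime, so 'Z_p is
   Z/pZ. *)
Definition sieve_data (P : set nat) (L : forall p : nat, {set 'Z_p}) :=
  [/\ P !=set0,
      (forall p, P p -> prime p) &
      (forall p, P p -> L p != finset.set0 /\ L p \proper [set: 'Z_p]%SET)].

(* The index sets of the finitary products and sums below are all finite. *)
Definition sieve_V (R : realType) (P : set nat) (L : forall p : nat, {set 'Z_p})
    (y : R) : R :=
  \big[*%R/1]_(p \in [set p : nat | P p /\ p%:R < y])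
    (1 - #|L p|%:R / p%:R : R)^-1.

Definition squarefree (m : nat) : bool :=
  (0 < m)%N && all (fun p => logn p m == 1%N) (primes m).

Definition sieve_h (R : realType) (P : set nat) (L : forall p : nat, {set 'Z_p})
    (m : nat) : R :=
  if squarefree m then
    \prod_(p <- primes m)
      (if p \in P then #|L p|%:R / (p%:R - #|L p|%:R) else 0)
  else 0.

Definition sieve_G (R : realType) (P : set nat) (L : forall p : nat, {set 'Z_p})
    (y : R) : R :=
  \sum_(m \in [set m : nat | (0 < m)%N /\ m%:R <= y]) sieve_h R P L m.

Definition sifted_set (R : realType) (P : set nat)
    (L : forall p : nat, {set 'Z_p}) (z N : R) : set nat :=
  [set n : nat | [/\ (1 <= n)%N, n%:R <= N &
     forall p, P p -> p%:R < z -> (n%:R : 'Z_p) \notin L p]].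

Lemma sieve_h_prime (R : realType) (P : set nat) (L : forall p : nat, {set 'Z_p})
    (p : nat) : prime p ->
  sieve_h R P L p = if p \in P then #|L p|%:R / (p%:R - #|L p|%:R) else 0.
Proof.
move=> pp; rewrite /sieve_h /squarefree primes_prime//= prime_gt0//= andbT.
by rewrite logn_prime// eqxx big_seq1.
Qed.

Lemma sieve_hM (R : realType) (P : set nat) (L : forall p : nat, {set 'Z_p})
    (m n : nat) : (0 < m)%N -> (0 < n)%N -> coprime m n ->
  sieve_h R P L (m * n) = sieve_h R P L m * sieve_h R P L n.
Proof.
move=> m0 n0 cmn.
have dmn p : p \in primes m -> p \in primes n -> False.
  move=> pm pn; move: cmn; rewrite coprime_has_primes// => /hasPn /(_ p pn).
  by rewrite /= pm.
have pmn : perm_eq (primes (m * n)) (primes m ++ primes n).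
  apply: uniq_perm; rewrite ?primes_uniq ?cat_uniq ?primes_uniq//= ?andbT.
    by apply/hasPn => p pn; apply/negP => pm; exact: (dmn p).
  by move=> p; rewrite primesM// mem_cat.
have logn0 p k : p \notin primes k -> logn p k = 0%N.
  by rewrite -logn_gt0 lt0n negbK => /eqP.
have sqM : squarefree (m * n) = squarefree m && squarefree n.
  rewrite /squarefree muln_gt0 m0 n0/= (perm_all _ pmn) all_cat.
  congr andb; apply: eq_in_all => p pP; rewrite lognM//.
    by rewrite (logn0 p n) ?addn0//; apply/negP; exact: dmn.
  by rewrite (logn0 p m) ?add0n//; apply/negP => /dmn; exact.
rewrite /sieve_h sqM; case: (squarefree m); last by rewrite mul0r.
case: (squarefree n); last by rewrite mulr0.
by rewrite (perm_big _ pmn) big_cat.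
Qed.

(* Main.v *)
Require Import Defs.
From mathcomp Require Import all_boot all_order all_algebra finmap.
From mathcomp Require Import all_classical all_reals all_analysis complex.
From mathcomp Require Import ring lra zify.

Set Implicit Arguments.
Unset Strict Implicit.
Unset Printing Implicit Defensive.

Import Order.TTheory GRing.Theory Num.Theory.
Import ComplexField.Normc.

Local Open Scope classical_set_scope.
Local Open Scope ring_scope.
Local Open Scope complex_scope.
Local Open Scope quotient_scope.

(** The inequality is proved by duality, with a Selberg majorant built only from
    the large sieving primes; discarding the small ones is what costs a power
    of [log (2 |B|)].

    Fix a threshold [y], a constant multiple of [|B|^2].  For a prime [p] of [P]
    put [h = lambda / (p - lambda)] and let [phi_p (n)] be [h] when [n mod p] is
    outside [L_p] and [-1] otherwise.  This function has mean zero, its Fourier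
    coefficients at the nonzero [a / p] are at most [h] in absolute value, and,
    taking only two values, it satisfies [phi_p^2 = h + (h - 1) phi_p].  Let
    [Phi (n)] be the sum, over the sets [A] of primes of [P] in [[y, z)] with
    product at most [z], of [\prod_(p in A) phi_p (n)].  On the sifted set [Phi] is the
    constant [W = \sum_A \prod_(p in A) h p], so [Phi^2 / W^2] majorizes the
    indicator of the sifted set.

    By duality ([large_sieve_of_majorant]) it is enough to bound
    [\sum_b' |\sum_n F (n) Phi (n)^2 e (n (b - b'))|] for each [b], where [F] is a
    Fejer-like weight of length about [N].  Expanding [Phi^2] into exponentials
    with frequencies [xi] ([weight_sq_fourier]) splits this sum in two.

    - The zero frequency has coefficient exactly [W], and since the points of
      [B] are [delta]-spaced it contributes [O (W (N + 1 / delta))].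

    - Every other frequency involves a prime [p >= y], so that its coefficient
      is at most [W \prod (4 h p) <= W / |B|]: this is where
      [lambda (p) <= M p^(1/4)] and the choice of [y] come in.  The frequencies
      are fractions whose differences have denominators at most [z^4 <= N], so
      they are [1 / N]-spaced, and all of them together contribute
      [O (N W / |B|)] for each of the [|B|] values of [b'].

    Hence the large sieve constant is [O ((N + 1 / delta) / W)].  Splitting each
    squarefree [m <= z] into its prime factors below and above [y] gives
    [G (z) <= 3 V (y) W] ([sieve_G_le]), and
    [V (y) <= T (log y)^kappa = O ((log (2 |B|))^kappa)].

    The spacing of a family of points is exploited twice, for [B] and for the
    frequencies [xi], both times through [fejer_sum_spaced]. *)

(** * Finite sums and complex absolute values *)

(** All counting in this development goes through this comparison: a sum is
    bounded by re-indexing its terms injectively into a larger sum. *)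
Lemma ler_sum_inj (R : numDomainType) (I J : eqType) (s : seq I) (s' : seq J)
    (g : I -> J) (F : I -> R) (H : J -> R) :
  uniq s -> {in s &, injective g} -> (forall i, i \in s -> g i \in s') ->
  (forall j, j \in s' -> 0 <= H j) -> (forall i, i \in s -> F i <= H (g i)) ->
  \sum_(i <- s) F i <= \sum_(j <- s') H j.
Proof.
elim: s s' => [|i s IH] s' /=.
  by move=> _ _ _ H0 _; rewrite big_nil big_seq sumr_ge0.
move=> /andP[si us] gi gs' H0 FH.
have gis : g i \in s' by rewrite gs' ?mem_head.
rewrite big_cons (perm_big _ (perm_to_rem gis)) /= big_cons lerD ?FH ?mem_head//.
apply: IH => //.
- by move=> a b ai bi; apply: gi; rewrite inE ?ai ?bi orbT.
- move=> a ai; have agi : g a != g i.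
    by apply: contraNneq si => /gi <- //; rewrite ?mem_head// inE ai orbT.
  have := gs' a; rewrite inE ai orbT => /(_ isT).
  by rewrite (perm_mem (perm_to_rem gis)) inE (negbTE agi).
- by move=> j /mem_rem; exact: H0.
- by move=> a ai; apply: FH; rewrite inE ai orbT.
Qed.

Lemma neq_set_ex (T : finType) (A B : {set T}) :
  A != B -> exists p, (p \in A) != (p \in B).
Proof.
move=> AB; apply/existsP; apply: contraNT AB; rewrite negb_exists => /forallP e.
by apply/eqP/setP => p; apply/eqP; rewrite -[_ == _]negbK.
Qed.

Lemma neq_ffun_ex (T : finType) (U : eqType) (f g : {ffun T -> U}) :
  f != g -> exists p, f p != g p.
Proof.
move=> fg; apply/existsP; apply: contraNT fg; rewrite negb_exists => /forallP e.
by apply/eqP/ffunP => p; apply/eqP; rewrite -[_ == _]negbK.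
Qed.

Section Norm.
Variable R : realType.
Implicit Types z w : R[i].

Lemma normc_ge0 z : 0 <= normc z.
Proof. by case: z => a b; exact: sqrtr_ge0. Qed.

Lemma normc_sqr (a b : R) : normc (a +i* b) ^+ 2 = a ^+ 2 + b ^+ 2.
Proof. by rewrite /normc sqr_sqrtr// addr_ge0 ?sqr_ge0. Qed.

Lemma normc_real (a : R) : normc a%:C = `|a|.
Proof. by rewrite /normc /= expr0n /= addr0 sqrtr_sqr. Qed.

Lemma mul_conjc z : z * z^*%C = (normc z ^+ 2)%:C.
Proof.
by case: z => a b; rewrite normc_sqr /real_complex_def; simpc; congr (_ +i* _); ring.
Qed.

Lemma normc_conjc z : normc z^*%C = normc z.
Proof. by case: z => a b; rewrite /normc /= sqrrN. Qed.

Lemma ler_normcD z w : normc (z + w) <= normc z + normc w.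
Proof. exact: le_normcD. Qed.

Lemma ler_normc_sum (I : Type) (s : seq I) (P : pred I) (F : I -> R[i]) :
  normc (\sum_(i <- s | P i) F i) <= \sum_(i <- s | P i) normc (F i).
Proof.
elim/big_rec2 : _ => [|i x y _ xy]; first by rewrite normc0.
by rewrite (le_trans (ler_normcD _ _))// lerD2l.
Qed.

Lemma normc_prod (I : Type) (s : seq I) (P : pred I) (F : I -> R[i]) :
  normc (\prod_(i <- s | P i) F i) = \prod_(i <- s | P i) normc (F i).
Proof.
elim/big_rec2 : _ => [|i x y _ <-]; first by rewrite normc1.
by rewrite normcM.
Qed.

End Norm.

(** * Exponentials and Dirichlet sums *)

Section Cis.
Variable R : realType.
Implicit Types x y t : R.

Definition cis x : R[i] := cos (2 * pi * x) +i* sin (2 * pi * x).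

Lemma cis0 : cis 0 = 1.
Proof. by rewrite /cis mulr0 cos0 sin0. Qed.

Lemma cisD x y : cis (x + y) = cis x * cis y.
Proof. by rewrite /cis mulrDr cosD sinD; simpc; congr (_ +i* _); ring. Qed.

Lemma cisN x : cis (- x) = (cis x)^*%C.
Proof. by rewrite /cis mulrN cosN sinN. Qed.

Lemma cis_nat (n : nat) : cis n%:R = 1.
Proof.
have e2 : 2 * pi = pi *+ 2 :> R by rewrite mulr_natl.
have := periodicn (@cosD2pi R) n 0; have := periodicn (@sinD2pi R) n 0.
by rewrite /cis e2 mulr_natr !add0r => -> ->; rewrite cos0 sin0.
Qed.

Lemma cis_int (k : int) : cis k%:~R = 1.
Proof.
case: k => n; first by rewrite -pmulrn cis_nat.
by rewrite NegzE rmorphN /= cisN -pmulrn cis_nat conjc1.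
Qed.

Lemma cisDint x (k : int) : cis (x + k%:~R) = cis x.
Proof. by rewrite cisD cis_int mulr1. Qed.

Lemma normc_cis x : normc (cis x) = 1.
Proof.
by apply/eqP; rewrite -(@eqrXn2 _ 2) ?normc_ge0// normc_sqr cos2Dsin2 expr1n.
Qed.

Lemma cis_sum (I : Type) (s : seq I) (P : pred I) (F : I -> R) :
  cis (\sum_(i <- s | P i) F i) = \prod_(i <- s | P i) cis (F i).
Proof. by rewrite (big_morph cis cisD cis0). Qed.

Lemma cis_mulrn x (n : nat) : cis (x *+ n) = cis x ^+ n.
Proof. by elim: n => [|n IH]; rewrite ?cis0// mulrS cisD IH exprS. Qed.

Lemma sqr_normc_1Bcis t : normc (1 - cis t) ^+ 2 = 2 - 2 * cos (2 * pi * t).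
Proof.
have := cos2Dsin2 (2 * pi * t); rewrite /cis.
have -> : (1 : R[i]) - (cos (2 * pi * t) +i* sin (2 * pi * t)) =
  (1 - cos (2 * pi * t)) +i* (- sin (2 * pi * t)) by simpc.
by rewrite normc_sqr => e; nra.
Qed.

Lemma normc_1Bcis_double t : normc (1 - cis (2 * t)) <= 2 * normc (1 - cis t).
Proof.
have -> : 1 - cis (2 * t) = (1 + cis t) * (1 - cis t).
  by rewrite mulr_natl mulr2n cisD; ring.
rewrite normcM ler_wpM2r ?normc_ge0//.
by rewrite (le_trans (ler_normcD _ _))// normc_cis normc1.
Qed.

(** A chord is at least a fixed multiple of its arc.  For arcs of at least a
    quarter turn the chord exceeds 1 because the cosine is nonpositive;
    doubling the arc at most doubles the chord, which brings every shorter arc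
    into that range. *)
Lemma chord_ge t : 0 <= t <= 1/2 -> 2 * t <= normc (1 - cis t).
Proof.
have base u : 1/4 <= u <= 1/2 -> 2 * u <= normc (1 - cis u).
  move=> /andP[u4 u2]; rewrite (@le_trans _ _ 1)//; first lra.
  rewrite -(@ler_pXn2r _ 2) ?nnegrE ?normc_ge0// expr1n sqr_normc_1Bcis.
  suff : cos (2 * pi * u) <= 0 by lra.
  have p0 := @pi_gt0 R.
  have -> : 2 * pi * u = (2 * pi * u - pi / 2) + pi / 2 by ring.
  by rewrite cosDpihalf oppr_le0 sin_ge0_pi//; apply/andP; split; nra.
have ind n u : 1 <= 2 ^+ n * u * 4 -> 0 <= u <= 1/2 -> 2 * u <= normc (1 - cis u).
  elim: n u => [|n IH] u; first by rewrite expr0 mul1r => ? ?; apply: base; lra.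
  move=> hn u01; have [u4|u4] := lerP (1/4) u; first by apply: base; lra.
  have := IH (2 * u); rewrite exprSr in hn.
  have -> : 2 ^+ n * (2 * u) * 4 = 2 ^+ n * 2 * u * 4 by ring.
  move=> /(_ hn) h; have : 0 <= 2 * u <= 1 / 2 by lra.
  by move=> /h h'; have := normc_1Bcis_double u; lra.
move=> /andP[]; rewrite le_eqVlt => /predU1P[<- _|t0 t2].
  by rewrite mulr0 normc_ge0.
have ht : 0 <= (4 * t)^-1 by rewrite invr_ge0; lra.
pose n := Num.truncn ((4 * t)^-1).
apply: (ind n.+1); last by rewrite ltW.
have : (4 * t)^-1 < n.+1%:R by exact: Num.Theory.truncnS_gt.
have : n.+1%:R <= 2 ^+ n.+1 :> R by rewrite -natrX ler_nat ltnW// ltn_expl.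
move=> h1 h2; have := lt_le_trans h2 h1; rewrite -div1r ltr_pdivrMr; nra.
Qed.

Lemma dirichlet_le_size x (m : nat) : normc (\sum_(j < m) cis (x *+ j)) <= m%:R.
Proof.
rewrite (le_trans (ler_normc_sum _ _ _))// (eq_bigr (fun=> 1)) => [|i _].
  by rewrite sumr_const card_ord.
exact: normc_cis.
Qed.

Lemma dirichlet_le_chord x (m : nat) :
  normc (1 - cis x) * normc (\sum_(j < m) cis (x *+ j)) <= 2.
Proof.
rewrite -normcM.
have -> : (1 - cis x) * \sum_(j < m) cis (x *+ j) = 1 - cis (x *+ m).
  under eq_bigr do rewrite cis_mulrn.
  by rewrite cis_mulrn -opprB mulNr -subrX1 opprB.
rewrite (le_trans (ler_normcD _ _))// normcN normc_cis.
by rewrite normc1.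
Qed.

Lemma chord_ge_dist x (k : int) : `|x + k%:~R| <= 1/2 ->
  2 * `|x + k%:~R| <= normc (1 - cis x).
Proof.
move=> hk; rewrite -(cisDint x k); set u := x + k%:~R.
have [u0|u0] := ger0P u.
  by apply: chord_ge; rewrite u0 /= -(ger0_norm u0).
have -> : normc (1 - cis u) = normc (1 - cis (- u)).
  by rewrite cisN -[LHS]normc_conjc rmorphB rmorph1.
by apply: chord_ge; rewrite oppr_ge0 (ltW u0)/= -(ltr0_norm u0).
Qed.

(** Away from the integers the geometric sum is small: it is
    [(1 - e (m x)) / (1 - e (x))], and the denominator is a chord. *)
Lemma dirichlet_le_inv x (k : int) (m : nat) : `|x + k%:~R| <= 1/2 ->
  `|x + k%:~R| * normc (\sum_(j < m) cis (x *+ j)) <= 1.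
Proof.
move=> /chord_ge_dist; have := dirichlet_le_chord x m.
have := normc_ge0 (\sum_(j < m) cis (x *+ j)).
move: (normc _) (normc _) (`|_|) => a b c; nra.
Qed.

End Cis.

(** * Fejer-like sums over well-spaced points *)

Section Spacing.
Variable R : realType.

(** The bound telescopes: the term of index [k + 1] is at most
    [1 / (eta (1 + k eta)) - 1 / (eta (1 + (k + 1) eta))]. *)
Lemma sum_inv_sqr_le (eta : R) (n : nat) : 0 < eta ->
  \sum_(k < n) ((1 + k%:R * eta) ^+ 2)^-1 <= 1 + eta^-1.
Proof.
move=> e0.
have pos k : 0 < 1 + k%:R * eta by rewrite ltr_pwDl// mulr_ge0 ?ler0n ?ltW.
case: n => [|n]; first by rewrite big_ord0 addr_ge0 ?invr_ge0 ?ltW.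
suff : \sum_(k < n.+1) ((1 + k%:R * eta) ^+ 2)^-1
       <= 1 + eta^-1 - (eta * (1 + n%:R * eta))^-1.
  move/le_trans; apply; rewrite gerBl invr_ge0 mulr_ge0 ?ltW//.
elim: n => [|n IH].
  by rewrite big_ord1 /= mul0r addr0 mulr1 expr1n invr1 addrK.
rewrite big_ord_recr /=; apply: le_trans (lerD IH (lexx _)) _.
set a := 1 + n%:R * eta; have a0 : 0 < a := pos n.
have -> : 1 + n.+1%:R * eta = a + eta by rewrite /a -natr1; ring.
have ae0 : 0 < a + eta by rewrite addr_gt0.
have key : ((a + eta) ^+ 2)^-1 <= (a * (a + eta))^-1.
  by rewrite lef_pV2 ?posrE ?exprn_gt0 ?mulr_gt0// expr2 ler_wpM2r ?ltW// ltrDl.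
have e : (eta * a)^-1 - (eta * (a + eta))^-1 = (a * (a + eta))^-1.
  by field; rewrite ?gt_eqF.
by move: key; rewrite -e; lra.
Qed.

(** Cutting the half-line into cells of length [delta] puts at most one point in
    each cell. *)
Lemma sum_spaced_line (I : eqType) (s : seq I) (t : I -> R) (delta m : R) :
  uniq s -> 0 < delta -> 0 < m -> (forall i, i \in s -> 0 <= t i) ->
  {in s &, forall i j, i != j -> delta <= `|t i - t j|} ->
  \sum_(i <- s) ((1 + m * t i) ^+ 2)^-1 <= 1 + (m * delta)^-1.
Proof.
move=> us d0 m0 t0 sp; pose g i := Num.truncn (t i / delta).
have gb i : i \in s -> (g i)%:R <= t i / delta < (g i).+1%:R.
  by move=> si; apply: truncn_itv; rewrite divr_ge0 ?t0 ?ltW.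
pose n := (\max_(i <- s) g i).+1.
apply: le_trans (sum_inv_sqr_le n (mulr_gt0 m0 d0)).
rewrite -(big_mkord xpredT (fun k : nat => ((1 + k%:R * (m * delta)) ^+ 2)^-1)).
apply: (@ler_sum_inj R I nat s _ g) => //.
- move=> i j si sj gij; apply/eqP; apply: contraT => /(sp i j si sj).
  move: (gb i si) (gb j sj); rewrite gij ler_pdivlMr// ltr_pdivrMr//.
  rewrite ler_pdivlMr// ltr_pdivrMr// -natr1 => /andP[a b] /andP[c d].
  suff : `|t i - t j| < delta by lra.
  by rewrite ltr_norml; apply/andP; split; nra.
- by move=> i si; rewrite mem_index_iota ltnS/= leq_bigmax_seq.
- by move=> j _; rewrite invr_ge0 sqr_ge0.
- move=> i si; have /andP[] := gb i si; rewrite ler_pdivlMr// => a _.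
  have gd : 0 <= (g i)%:R * (m * delta) by rewrite !mulr_ge0 ?ler0n ?ltW.
  have mt : 0 <= m * t i by rewrite mulr_ge0 ?t0 ?ltW.
  rewrite lef_pV2 ?posrE ?exprn_gt0 ?ltr_pwDl//.
  rewrite ler_pXn2r ?nnegrE ?addr_ge0// lerD2l mulrCA.
  exact: (ler_wpM2l (ltW m0)).
Qed.

(** The absolute value at [x] of the Fourier transform of the weight
    [F (n) = #{(j, k) : j < 2 m, k < m, j - k = n} / m].  The two ranges have
    different lengths so that [F] is constantly 1 on [[0, m)]. *)
Definition fejer (m : nat) (x : R) : R :=
  m%:R^-1 * (normc (\sum_(j < m.*2) cis (x *+ j))
             * normc (\sum_(j < m) cis (x *+ j))).

Lemma fejer_ge0 m x : 0 <= fejer m x.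
Proof. by rewrite /fejer !mulr_ge0 ?invr_ge0 ?normc_ge0. Qed.

(** One bound for both regimes: [fejer m x] is at most [2 m] everywhere and at
    most [1 / (m t^2)] at distance [t] from the integers. *)
Lemma fejer_le m x (k : int) : (0 < m)%N -> `|x + k%:~R| <= 1/2 ->
  fejer m x <= 6 * m%:R * ((1 + m%:R * `|x + k%:~R|) ^+ 2)^-1.
Proof.
move=> m0 hk; have M0 : 0 < m%:R :> R by rewrite ltr0n.
have key (a b t : R) : 0 <= a -> 0 <= b -> 0 <= t -> a <= m.*2%:R -> b <= m%:R ->
    t * a <= 1 -> t * b <= 1 ->
    m%:R^-1 * (a * b) <= 6 * m%:R * ((1 + m%:R * t) ^+ 2)^-1.
  rewrite -muln2 natrM => a0 b0 t0 am bm ta tb.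
  have D0 : 0 < 1 + m%:R * t by rewrite ltr_pwDl// mulr_ge0 ?ler0n.
  rewrite mulrC ler_pdivrMr// mulrAC ler_pdivlMr ?exprn_gt0//.
  have ab1 : a * b <= (m%:R * 2) * m%:R by exact: ler_pM.
  have ab2 : (t * a) * (t * b) <= 1 by rewrite mulr_ile1 ?mulr_ge0.
  have ab3 : m%:R ^+ 2 * ((t * a) * (t * b)) <= m%:R ^+ 2.
    by rewrite ler_piMr ?sqr_ge0.
  have ab0 : 0 <= a * b by rewrite mulr_ge0.
  have h : 0 <= a * b * (1 - m%:R * t) ^+ 2 by rewrite mulr_ge0 ?sqr_ge0.
  by move: ab1 ab3 h; set c := m%:R : R; rewrite !expr2 => ab1 ab3 h; nra.
apply: key; rewrite ?normc_ge0 ?normr_ge0 ?dirichlet_le_size//;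
  exact: dirichlet_le_inv.
Qed.

(** Representing each point modulo 1 in [[-1/2, 1/2)] and separating the signs
    reduces the circle to two half-lines. *)
Lemma fejer_sum_spaced (I : eqType) (s : seq I) (x : I -> R) (delta : R)
    (m : nat) :
  uniq s -> 0 < delta -> (0 < m)%N ->
  {in s &, forall i j, i != j -> forall k : int,
     delta <= `|x i - x j + k%:~R|} ->
  \sum_(i <- s) fejer m (x i) <= 12 * (m%:R + delta^-1).
Proof.
move=> us d0 m0 sp; have M0 : 0 < m%:R :> R by rewrite ltr0n.
pose k i := - Num.floor (x i + 1/2); pose u i := x i + (k i)%:~R.
have u2 i : `|u i| <= 1/2.
  have := floor_itv (x i + 1/2); rewrite intrD rmorph1 => /andP[a b].
  rewrite ler_norml /u /k rmorphN /=; apply/andP; split; lra.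
have usp i j : i \in s -> j \in s -> i != j -> delta <= `|u i - u j|.
  move=> si sj ij; have := sp _ _ si sj ij (k i - k j).
  by rewrite rmorphB /= /u; congr (_ <= `| _ |); ring.
have half (P : pred I) : {in P &, forall i j, `|u i - u j| = `|(`|u i| - `|u j|)|} ->
    \sum_(i <- s | P i) fejer m (x i) <= 6 * (m%:R + delta^-1).
  move=> hP; rewrite -big_filter.
  have sl := @sum_spaced_line I [seq i <- s | P i] (fun i => `|u i|)
    delta m%:R (filter_uniq _ us) d0 M0.
  apply: (@le_trans _ _ (6 * m%:R * (1 + (m%:R * delta)^-1))).
    apply: le_trans (_ : 6 * m%:R * _ <= _); last first.
      apply: ler_wpM2l; first by rewrite mulr_ge0.
      apply: sl => [i _|i j]; first exact: normr_ge0.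
      rewrite !mem_filter => /andP[Pi si] /andP[Pj sj] ij.
      by rewrite -hP//; exact: usp.
    rewrite mulr_sumr; apply: ler_sum => i _.
    by apply: (@fejer_le m (x i) (k i) m0); exact: u2.
  rewrite le_eqVlt; apply/orP; left; apply/eqP; field.
  by rewrite !gt_eqF.
rewrite (bigID (fun i => 0 <= u i))/=.
have -> : 12 * (m%:R + delta^-1) = 6 * (m%:R + delta^-1) + 6 * (m%:R + delta^-1).
  by ring.
apply: lerD; apply: half => i j; rewrite /in_mem /=.
  by move=> ui uj; rewrite (ger0_norm ui) (ger0_norm uj).
rewrite -!ltNge => ui uj; rewrite (ltr0_norm ui) (ltr0_norm uj).
by rewrite -normrN; congr `| _ |; ring.
Qed.

End Spacing.

(** * Duality and majorants *)

Section Duality.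
Variable R : realType.

(** Each [n < m] is [j - k] with [j < 2 m] once for every [k < m]. *)
Lemma sum_le_fejer (m : nat) (S : pred nat) (f : int -> R) :
  (forall n, 0 <= f n) ->
  m%:R * \sum_(n < m | S n) f n%:Z
    <= \sum_(k < m) \sum_(j < m.*2) f (j%:Z - k%:Z).
Proof.
move=> f0; set T := \sum_(n < m | S n) _.
have -> : m%:R * T = \sum_(k < m) T by rewrite sumr_const card_ord mulr_natl.
apply: ler_sum => k _; rewrite {}/T.
rewrite -(big_mkord xpredT (fun j => f (j%:Z - k%:Z))).
rewrite -(big_mkord S (fun n => f n%:Z)) -big_filter.
apply: (@ler_sum_inj R _ _ _ _ (fun n => (n + k)%N)).
- by rewrite filter_uniq// iota_uniq.
- by move=> a b _ _ /addIn.
- move=> n; rewrite mem_filter !mem_index_iota => /andP[_ /andP[_ nm]].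
  by rewrite /= -addnn -addSn leq_add// ltnW.
- by move=> j _; exact: f0.
- by move=> n _; rewrite PoszD addrK.
Qed.

(** Opening the square turns the left side into a Hermitian form in [c] with
    entries bounded by [\sum_f |w f| fejer]; such a form is at most its largest
    row or column sum (Schur's test). *)
Lemma quadratic_form_le (I : eqType) (s : seq I) (x : I -> R) (J : finType)
    (w : J -> R[i]) (xi : J -> R) (m : nat) (Lam : R) (Phi : int -> R)
    (c : I -> R[i]) :
  (0 < m)%N ->
  (forall n, (Phi n)%:C = \sum_f w f * cis (n%:~R * xi f)) ->
  (forall b, b \in s -> \sum_(b' <- s) \sum_f
     normc (w f) * fejer m (x b - x b' + xi f) <= Lam) ->
  (forall b, b \in s -> \sum_(b' <- s) \sum_f
     normc (w f) * fejer m (x b' - x b + xi f) <= Lam) ->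
  \sum_(k < m) \sum_(j < m.*2)
     Phi (j%:Z - k%:Z) * normc (\sum_(b <- s) c b * cis ((j%:Z - k%:Z)%:~R * x b)) ^+ 2
  <= m%:R * Lam * \sum_(b <- s) normc (c b) ^+ 2.
Proof.
move=> m0 hPhi row col; have M0 : 0 < m%:R :> R by rewrite ltr0n.
set X := leLHS.
pose D n (t : R) : R[i] := \sum_(j < n) cis (t *+ j).
pose th b b' f := x b - x b' + xi f.
have step n : (Phi n * normc (\sum_(b <- s) c b * cis (n%:~R * x b)) ^+ 2)%:C =
    \sum_(b <- s) \sum_(b' <- s) \sum_f
       w f * c b * (c b')^*%C * cis (n%:~R * th b b' f).
  have cjE : (\sum_(b <- s) c b * cis (n%:~R * x b))^*%C =
      \sum_(b <- s) (c b)^*%C * cis (- (n%:~R * x b)).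
    rewrite rmorph_sum; apply: eq_bigr => b _; rewrite cisN; exact: rmorphM.
  rewrite rmorphM /= -mul_conjc cjE big_distrlr /= mulr_sumr.
  apply: eq_bigr => b _; rewrite mulr_sumr; apply: eq_bigr => b' _.
  rewrite hPhi mulr_suml; apply: eq_bigr => f _.
  rewrite /th mulrDr mulrBr !cisD; ring.
have XE : X%:C = \sum_(b <- s) \sum_(b' <- s) \sum_f
       w f * c b * (c b')^*%C * (D m.*2 (th b b' f) * (D m (th b b' f))^*%C).
  rewrite /X rmorph_sum /=.
  under eq_bigr => k _.
    rewrite rmorph_sum /=; under eq_bigr do rewrite step.
    rewrite exchange_big /=; under eq_bigr do rewrite exchange_big /=.
    under eq_bigr do under eq_bigr do rewrite exchange_big /=.
    over.
  rewrite exchange_big /=; apply: eq_bigr => b _.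
  rewrite exchange_big /=; apply: eq_bigr => b' _.
  rewrite exchange_big /=; apply: eq_bigr => f _.
  under eq_bigr do rewrite -mulr_sumr.
  rewrite -mulr_sumr; congr (_ * _).
  have -> : (D m (th b b' f))^*%C = \sum_(k < m) cis (- (th b b' f *+ k)).
    by rewrite /D rmorph_sum; apply: eq_bigr => k _; rewrite cisN.
  rewrite /D mulr_sumr; apply: eq_bigr => k _.
  rewrite mulr_suml; apply: eq_bigr => j _.
  rewrite -cisD; congr cis.
  by rewrite rmorphB /= mulrBl !mulr_natl.
have XN : X <= \sum_(b <- s) \sum_(b' <- s) \sum_f
    m%:R * (normc (c b) * normc (c b')) * (normc (w f) * fejer m (th b b' f)).
  rewrite (le_trans (ler_norm X))// -normc_real XE.
  rewrite (le_trans (ler_normc_sum _ _ _))//; apply: ler_sum => b _.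
  rewrite (le_trans (ler_normc_sum _ _ _))//; apply: ler_sum => b' _.
  rewrite (le_trans (ler_normc_sum _ _ _))//; apply: ler_sum => f _.
  rewrite !normcM !normc_conjc /fejer -/(D _ _) -/(D _ _) le_eqVlt.
  by apply/orP; left; apply/eqP; field; rewrite gt_eqF.
apply: (le_trans XN).
pose W b b' := \sum_f normc (w f) * fejer m (th b b' f).
have W0 b b' : 0 <= W b b'.
  by apply: sumr_ge0 => f _; rewrite mulr_ge0 ?normc_ge0 ?fejer_ge0.
apply: (@le_trans _ _ (\sum_(b <- s) \sum_(b' <- s)
    (m%:R / 2) * (normc (c b) ^+ 2 * W b b' + normc (c b') ^+ 2 * W b b'))).
  apply: ler_sum => b _; apply: ler_sum => b' _; rewrite -mulr_sumr -/(W b b').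
  rewrite -mulrDl [leRHS]mulrA ler_wpM2r// -mulrA ler_wpM2l ?ler0n//.
  by have := sqr_ge0 (normc (c b) - normc (c b')); lra.
under eq_bigr do rewrite -mulr_sumr big_split /=.
rewrite -mulr_sumr big_split /=.
have -> : m%:R * Lam * (\sum_(b <- s) normc (c b) ^+ 2) =
  m%:R / 2 * (\sum_(b <- s) normc (c b) ^+ 2 * Lam
              + \sum_(b <- s) normc (c b) ^+ 2 * Lam).
  by rewrite -mulr_suml; field.
rewrite ler_wpM2l ?divr_ge0 ?ler0n//; apply: lerD.
  rewrite big_seq [leRHS]big_seq; apply: ler_sum => b sb.
  by rewrite -mulr_sumr ler_wpM2l ?sqr_ge0//; exact: row.
rewrite exchange_big /= big_seq [leRHS]big_seq; apply: ler_sum => b sb.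
by rewrite -mulr_sumr ler_wpM2l ?sqr_ge0//; exact: col.
Qed.

(** With [S_b] the sum at [b] and [g (n) = \sum_b conj (S_b) e (n b)], the left
    side [X] is also [\sum_n a n * g (n)].  Bounding [\sum_n |g (n)|^2] by
    [(Lam / G) X] through the majorant [Phi / G] leaves [X] on both sides, and
    the Cauchy-Schwarz inequality solves for it. *)
Lemma large_sieve_of_majorant (I : eqType) (s : seq I) (x : I -> R) (J : finType)
    (w : J -> R[i]) (xi : J -> R) (m : nat) (Lam G : R) (Phi : int -> R)
    (S : pred nat) (a : nat -> R[i]) :
  (0 < m)%N -> 0 < Lam -> 0 < G -> (forall n, 0 <= Phi n) ->
  (forall n : nat, S n -> G <= Phi n%:Z) ->
  (forall n, (Phi n)%:C = \sum_f w f * cis (n%:~R * xi f)) ->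
  (forall b, b \in s -> \sum_(b' <- s) \sum_f
     normc (w f) * fejer m (x b - x b' + xi f) <= Lam) ->
  (forall b, b \in s -> \sum_(b' <- s) \sum_f
     normc (w f) * fejer m (x b' - x b + xi f) <= Lam) ->
  \sum_(b <- s) normc (\sum_(n < m | S n) a n * cis (x b *+ n)) ^+ 2
  <= Lam / G * \sum_(n < m | S n) normc (a n) ^+ 2.
Proof.
move=> m0 L0 G0 Phi0 GPhi hPhi row col; have M0 : 0 < m%:R :> R by rewrite ltr0n.
pose S' b := \sum_(n < m | S n) a n * cis (x b *+ n).
pose c b := (S' b)^*%C.
pose g (n : int) := \sum_(b <- s) c b * cis (n%:~R * x b).
set X := leLHS; set A := \sum_(n < m | _) _.
have gX : G * \sum_(n < m | S n) normc (g n%:Z) ^+ 2 <= Lam * X.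
  have := quadratic_form_le c m0 hPhi row col.
  have -> : \sum_(b <- s) normc (c b) ^+ 2 = X.
    by apply: eq_bigr => b _; rewrite normc_conjc.
  have := @sum_le_fejer m S (fun n => Phi n * normc (g n) ^+ 2).
  move=> /(_ (fun n => mulr_ge0 (Phi0 n) (sqr_ge0 _))) h1 h2.
  have := le_trans h1 h2; rewrite -mulrA ler_pM2l//; apply: le_trans.
  rewrite mulr_sumr; apply: ler_sum => n Sn.
  by rewrite ler_wpM2r ?sqr_ge0//; exact: GPhi.
have XE : X%:C = \sum_(n < m | S n) a n * g n%:Z.
  rewrite /X rmorph_sum /=.
  under eq_bigr => b _ do rewrite -mul_conjc -/(S' b) -/(c b) mulr_suml.
  rewrite exchange_big /=; apply: eq_bigr => n _.
  rewrite /g mulr_sumr; apply: eq_bigr => b _.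
  by rewrite -pmulrn mulr_natl; ring.
have X0 : 0 <= X by apply: sumr_ge0 => b _; exact: sqr_ge0.
have LG0 : 0 < Lam / G by rewrite divr_gt0.
(* Cauchy-Schwarz as [2 u v <= t u^2 + v^2 / t], with [t = Lam / G] chosen so
   that the last term is at most [X]. *)
have XA : 2 * X <= Lam / G * A + (Lam / G)^-1 * \sum_(n < m | S n) normc (g n%:Z) ^+ 2.
  rewrite -(ger0_norm X0) -normc_real XE /A !mulr_sumr -big_split /=.
  apply: le_trans (_ : 2 * \sum_(n < m | S n) normc (a n * g n%:Z) <= _).
    by rewrite ler_wpM2l//; exact: ler_normc_sum.
  rewrite mulr_sumr; apply: ler_sum => n _; rewrite normcM.
  set t := Lam / G; rewrite -subr_ge0.
  have -> : t * normc (a n) ^+ 2 + t^-1 * normc (g n) ^+ 2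
      - 2 * (normc (a n) * normc (g n)) = t^-1 * (t * normc (a n) - normc (g n)) ^+ 2.
    by field; rewrite gt_eqF.
  by rewrite mulr_ge0 ?sqr_ge0// invr_ge0 ltW.
have : (Lam / G)^-1 * \sum_(n < m | S n) normc (g n%:Z) ^+ 2 <= X.
  by rewrite invf_div mulrAC ler_pdivrMr// mulrC [X * _]mulrC mulrC; move: gX; rewrite mulrC.
lra.
Qed.

End Duality.

(** * Fourier expansion of the square of a sieve weight *)

Section SquareExpansion.
Variables (R : realType) (Z : nat).
Local Notation I := 'I_Z.+1.
Variables (D : {set {set I}}) (h : I -> R) (phi : I -> int -> R).
Variable gam : I -> I -> R[i].

(** For two sets [A] and [A'], the product of [\prod_(p in A) phi p] and
    [\prod_(p in A') phi p] is [\prod_p (sq_const p + sq_lin p * phi p)]: the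
    factor at [p] is [phi p ^ 2 = h p + (h p - 1) phi p] on both sets, [phi p] on
    exactly one, and 1 elsewhere. *)
Definition sq_const (A A' : {set I}) p : R :=
  if (p \in A) && (p \in A') then h p
  else if (p \in A) || (p \in A') then 0 else 1.

Definition sq_lin (A A' : {set I}) p : R :=
  if (p \in A) && (p \in A') then h p - 1
  else if (p \in A) || (p \in A') then 1 else 0.

(** A frequency is a choice [f] of a numerator for each denominator [p], the
    value 0 meaning that [p] does not occur.  With [gam p] the Fourier
    coefficients of [phi p], this is the coefficient at [frac_freq f] of the
    product attached to [A] and [A']. *)
Definition sq_coef (A A' : {set I}) (f : {ffun I -> I}) : R[i] :=
  \prod_p (if f p == ord0 then (sq_const A A' p)%:C
           else (sq_lin A A' p)%:C * gam p (f p)).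

Definition weight_sum : R := \sum_(A in D) \prod_(p in A) h p.

Definition weight_sq (n : int) : R := (\sum_(A in D) \prod_(p in A) phi p n) ^+ 2.

Definition weight_coef (f : {ffun I -> I}) : R[i] :=
  \sum_(A in D) \sum_(A' in D) sq_coef A A' f.

Definition frac_freq (f : {ffun I -> I}) : R := \sum_p (f p)%:R / p%:R.

Hypothesis phi_sq : forall p n, phi p n ^+ 2 = h p + (h p - 1) * phi p n.
Hypothesis phi_fourier : forall p n, (phi p n)%:C =
  \sum_(a : I | a != ord0) gam p a * cis (n%:~R * (a%:R / p%:R)).
Hypothesis h_ge0 : forall p, 0 <= h p.
Hypothesis h_le2 : forall p, h p <= 2.
Hypothesis gam_le : forall p a, normc (gam p a) <= h p.
Hypothesis D_down : forall A E : {set I}, A \in D -> E \subset A -> E \in D.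

Lemma weight_sq_fourier n :
  (weight_sq n)%:C = \sum_f weight_coef f * cis (n%:~R * frac_freq f).
Proof.
have pairE (A A' : {set I}) :
    ((\prod_(p in A) phi p n) * (\prod_(p in A') phi p n))%:C =
    \sum_f sq_coef A A' f * cis (n%:~R * frac_freq f).
  rewrite big_mkcond [X in _ * X]big_mkcond -big_split /= rmorph_prod /=.
  transitivity (\prod_p \sum_(a : I)
      (if a == ord0 then (sq_const A A' p)%:C else (sq_lin A A' p)%:C * gam p a)
       * cis (n%:~R * (a%:R / p%:R))).
    apply: eq_bigr => p _.
    rewrite (bigD1 ord0) //= mul0r mulr0 cis0 mulr1.
    under eq_bigr => a /negbTE -> do rewrite -mulrA.
    rewrite -mulr_sumr -phi_fourier -rmorphM -rmorphD /=; congr (_%:C).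
    rewrite /sq_const /sq_lin; case: (p \in A); case: (p \in A') => /=.
    - by rewrite -phi_sq expr2.
    - by rewrite mulr1 add0r mul1r.
    - by rewrite !mul1r add0r.
    - by rewrite mul0r addr0 mulr1.
  rewrite bigA_distr_bigA /=; apply: eq_bigr => f _.
  by rewrite big_split /= -cis_sum /frac_freq mulr_sumr.
rewrite /weight_sq expr2 big_distrlr /= rmorph_sum /=.
under eq_bigr => A _.
  rewrite rmorph_sum /=; under eq_bigr do rewrite pairE.
  rewrite exchange_big /=; over.
rewrite exchange_big /=; apply: eq_bigr => f _.
rewrite /weight_coef mulr_suml; apply: eq_bigr => A _.
by rewrite mulr_suml.
Qed.

(** Only the diagonal [A = A'] has a constant term, namely
    [\prod_(p in A) h p]. *)
Lemma weight_coef0 : weight_coef [ffun=> ord0] = weight_sum%:C.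
Proof.
rewrite /weight_coef /weight_sum rmorph_sum /=; apply: eq_bigr => A AD.
rewrite (bigD1 A)//= [X in _ + X]big1 ?addr0.
  rewrite /sq_coef [in RHS]big_mkcond rmorph_prod /=; apply: eq_bigr => p _.
  by rewrite ffunE eqxx /sq_const andbb orbb; case: (p \in A).
move=> A' /andP[_ AA']; apply/eqP; rewrite prodf_seq_eq0; apply/hasP.
have [p pAA'] := neq_set_ex AA'.
exists p; first by rewrite mem_index_enum.
rewrite ffunE eqxx /sq_const /=.
by move: pAA'; case: (p \in A); case: (p \in A') => //= _; rewrite eqxx.
Qed.

(** [A] is determined by [A :\: r] and the subset [A :&: r] of [r]. *)
Lemma sum_setD_le (r : {set I}) (H : {set I} -> R) : (forall E, 0 <= H E) ->
  \sum_(A in D) H (A :\: r) <= 2 ^+ #|r| * \sum_(E in D) H E.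
Proof.
move=> H0.
have -> : 2 ^+ #|r| * \sum_(E in D) H E =
    \sum_(u : {set I} * {set I} | (u.1 \in D) && (u.2 \in powerset r)) H u.1.
  rewrite -(pair_big (mem D) (mem (powerset r)) (fun E _ => H E)) /= mulr_sumr.
  by apply: eq_bigr => E _; rewrite sumr_const card_powerset -[RHS]mulr_natl natrX.
rewrite -big_filter -[leRHS]big_filter.
apply: (@ler_sum_inj R _ _ _ _ (fun A => (A :\: r, A :&: r))) => //.
- by rewrite filter_uniq// index_enum_uniq.
- by move=> A A' _ _ [e1 e2]; rewrite -(setID A r) -(setID A' r) e1 e2.
- move=> A; rewrite !mem_filter !mem_index_enum /= !andbT => AD.
  by rewrite (D_down AD) ?subsetDl//= inE subsetIr.
Qed.

(** Let [r] be the support of [f].  The factors outside [r] vanish unless [A] and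
    [A'] agree there, and then give [\prod_(p in A :\: r) h p]; the factors inside
    [r] are at most [h p], since [|h p - 1| <= 1].  The sets [A] and [A'] being
    free inside [r], there are [4 ^ |r|] pairs for a given common part. *)
Lemma weight_coef_le f :
  normc (weight_coef f) <= weight_sum * \prod_(p | f p != ord0) (4 * h p).
Proof.
pose r : {set I} := [set p | f p != ord0]%SET.
pose H (E : {set I}) := \prod_(p in E) h p.
have H0 E : 0 <= H E by apply: prodr_ge0 => p _.
have coefE (A A' : {set I}) : normc (sq_coef A A' f) <=
    (A' :\: r == A :\: r)%:R * (H (A :\: r) * \prod_(p in r) h p).
  rewrite /sq_coef normc_prod.
  have -> : \prod_i normc (if f i == ord0 then (sq_const A A' i)%:C
      else (sq_lin A A' i)%:C * gam i (f i)) =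
      (\prod_(p in r) normc ((sq_lin A A' p)%:C * gam p (f p)))
      * \prod_(p | p \notin r) sq_const A A' p.
    rewrite (bigID (mem r)) /=; congr (_ * _); apply: eq_bigr => p.
      by rewrite inE => /negbTE ->.
    rewrite inE negbK => ->; rewrite normc_real ger0_norm// /sq_const.
    by case: ifP => // _; case: ifP.
  have lin : \prod_(p in r) normc ((sq_lin A A' p)%:C * gam p (f p)) <=
      \prod_(p in r) h p.
    apply: ler_prod => p _; rewrite normc_ge0/= normcM normc_real -[leRHS]mul1r.
    rewrite ler_pM ?normc_ge0// /sq_lin ler_norml.
    have := h_ge0 p; have := h_le2 p => h2 h0.
    by case: ifP => _; [|case: ifP => _]; apply/andP; split; lra.
  have const : \prod_(p | p \notin r) sq_const A A' p =
      (A' :\: r == A :\: r)%:R * H (A :\: r).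
    case: eqP => [e|/eqP AA'].
      rewrite mul1r /H [RHS]big_mkcond [LHS]big_mkcond; apply: eq_bigr => p _.
      move/setP: e => /(_ p); rewrite /sq_const !inE.
      by case: (f p != ord0) => //= ->; rewrite andbb orbb; case: (p \in A).
    rewrite mul0r; apply/eqP; rewrite prodf_seq_eq0; apply/hasP.
    have [p pAA'] := neq_set_ex AA'.
    exists p; first by rewrite mem_index_enum.
    move: pAA'; rewrite !inE /sq_const; case: (f p != ord0) => //=.
    by case: (p \in A); case: (p \in A') => //= _; rewrite eqxx.
  rewrite const mulrC -mulrA; apply: ler_wpM2l => //.
  by apply: ler_wpM2l => //; exact: H0.
rewrite (le_trans (ler_normc_sum _ _ _))//.
have P0 : 0 <= \prod_(p in r) h p by apply: prodr_ge0.
apply: (@le_trans _ _ (\sum_(A in D) \sum_(A' in D)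
    (A' :\: r == A :\: r)%:R * (H (A :\: r) * \prod_(p in r) h p))).
  apply: ler_sum => A _; rewrite (le_trans (ler_normc_sum _ _ _))//.
  by apply: ler_sum => A' _; exact: coefE.
apply: (@le_trans _ _ (\sum_(A in D)
    2 ^+ #|r| * (H (A :\: r) * \prod_(p in r) h p))).
  apply: ler_sum => A _; rewrite -mulr_suml ler_wpM2r ?mulr_ge0//.
  have := @sum_setD_le r (fun E => (E == A :\: r)%:R) (fun=> ler0n _ _).
  move=> /le_trans; apply; rewrite ler_piMr ?exprn_ge0//.
  rewrite big_mkcond (bigD1 (A :\: r))//= big1 ?addr0.
    by case: ifP => // _; rewrite eqxx.
  by move=> E /negbTE ->; case: ifP.
rewrite -mulr_sumr -mulr_suml.
apply: (@le_trans _ _ (2 ^+ #|r| * (2 ^+ #|r| * weight_sum * \prod_(p in r) h p))).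
  by rewrite ler_wpM2l ?exprn_ge0// ler_wpM2r//; exact: sum_setD_le.
rewrite le_eqVlt; apply/orP; left; apply/eqP.
rewrite big_split /= prodr_const.
have -> : \prod_(i | f i != ord0) h i = \prod_(p in r) h p.
  by apply: eq_bigl => p; rewrite inE.
have -> : #|[pred i | f i != ord0]| = #|r| by apply: eq_card => p; rewrite !inE.
have -> : 4 = 2 * 2 :> R by ring.
by rewrite exprMn; ring.
Qed.

Lemma weight_coef_neq0 f : weight_coef f != 0 ->
  exists A A' : {set I}, [/\ A \in D, A' \in D &
    forall p, f p != ord0 -> (p \in A :|: A') && (gam p (f p) != 0)].
Proof.
rewrite /weight_coef => /eqP nz; apply: contrapT => none; apply: nz.
rewrite big1// => A AD; rewrite big1// => A' A'D.
apply/eqP; rewrite prodf_seq_eq0; apply/hasP; apply: contrapT => nh.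
apply: none; exists A, A'; split=> // p fp.
rewrite inE; apply/negPn/negP => bad; apply: nh.
exists p; first by rewrite mem_index_enum.
rewrite (negbTE fp) /sq_lin /=; move: bad.
case: (p \in A); case: (p \in A') => /=; rewrite ?negbK;
  try (by move=> /eqP ->; rewrite mulr0).
by move=> _; rewrite mul0r.
Qed.

End SquareExpansion.

(** * Fractions with squarefree denominators *)

Section Fractions.
Variable R : realType.

Lemma cis_eq1 (t : R) : cis t = 1 -> exists k : int, t = k%:~R.
Proof.
move=> e; pose k := Num.floor (t + 1/2); exists k.
have : `|t + (- k)%:~R| <= 1/2.
  have := floor_itv (t + 1/2); rewrite intrD rmorph1 => /andP[a b].
  rewrite ler_norml /k rmorphN /=; apply/andP; split; lra.
move=> /chord_ge_dist; rewrite e subrr normc0 pmulr_rle0// normr_le0 rmorphN /=.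
by rewrite subr_eq0 => /eqP.
Qed.

Lemma sum_cis_frac (p : nat) (k : int) : (0 < p)%N ->
  \sum_(a < p) cis (k%:~R * (a%:R / p%:R)) =
    ((p %| k)%Z * p)%:R :> R[i].
Proof.
move=> p0; have P0 : p%:R != 0 :> R by rewrite pnatr_eq0 -lt0n.
set z : R[i] := cis (k%:~R / p%:R).
have zE (a : nat) : cis (k%:~R * (a%:R / p%:R)) = z ^+ a.
  by rewrite -cis_mulrn -mulr_natr; congr cis; field.
under eq_bigr do rewrite zE.
case: (boolP (p %| k)%Z) => [/dvdzP[q kE]|pk]; rewrite ?mul1n ?mul0n.
  have -> : z = 1 by rewrite /z kE intrM mulfK// cis_int.
  by under eq_bigr do rewrite expr1n; rewrite sumr_const card_ord.
have z1 : z != 1.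
  apply: contraNneq pk => /cis_eq1[q e]; apply/dvdzP; exists q.
  apply/eqP; rewrite -(eqr_int R) intrM -e; apply/eqP.
  by rewrite -pmulrn mulfVK.
apply/eqP; have : (z - 1) * (\sum_(a < p) z ^+ a) == 0.
  by rewrite -subrX1 /z -cis_mulrn -[_ *+ p]mulr_natr mulfVK// cis_int subrr.
by rewrite mulf_eq0 subr_eq0 (negbTE z1).
Qed.

(** The difference times the common denominator is an integer.  It is not zero:
    modulo a prime [p0] at which [f] and [f'] differ, only the terms at [p0]
    survive. *)
Lemma frac_freq_spaced (Z : nat) (s : {set 'I_Z.+1})
    (f f' : {ffun 'I_Z.+1 -> 'I_Z.+1}) (k : int) :
  (forall p, p \in s -> prime p) ->
  (forall p, p \in s -> (f p < p)%N && (f' p < p)%N) ->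
  (forall p, p \notin s -> (f p == ord0) && (f' p == ord0)) -> f != f' ->
  1 <= (\prod_(p in s) (p : nat))%:R * `|frac_freq R f - frac_freq R f' + k%:~R|.
Proof.
move=> sp fs fns ff'.
pose Q (p : 'I_Z.+1) := \prod_(q in s | q != p) (q : nat).
have QE p : p \in s -> (\prod_(q in s) (q : nat) = p * Q p)%N.
  by move=> ps; rewrite (bigD1 p).
pose X : int := \sum_(p in s) ((f p)%:Z - (f' p)%:Z) * (Q p)%:Z
                + k * (\prod_(p in s) (p : nat))%:Z.
have XE : (\prod_(p in s) (p : nat))%:R * (frac_freq R f - frac_freq R f' + k%:~R)
    = X%:~R.
  rewrite /X intrD intrM mulrDr [k%:~R * _]mulrC; congr (_ + _).
  rewrite /frac_freq -sumrB mulr_sumr rmorph_sum /= [RHS]big_mkcond /=.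
  apply: eq_bigr => p _; case: ifP => ps; last first.
    by have /andP[/eqP -> /eqP ->] := fns p (negbT ps); rewrite mul0r subrr mulr0.
  rewrite (QE p ps) natrM rmorphM rmorphB /=; field.
  by rewrite pnatr_eq0 -lt0n prime_gt0 ?sp.
rewrite -[X in X * _]ger0_norm// -normrM XE.
rewrite -intr_norm -[1]/(1%:~R) ler_int.
suff : X != 0 by rewrite -normr_gt0; lia.
have [p0 fp0] := neq_ffun_ex ff'.
have p0s : p0 \in s.
  apply: contraNT fp0 => /fns /andP[/eqP -> /eqP ->]; exact: eqxx.
have pp0 := sp _ p0s.
apply/negP => /eqP X0.
have : (p0 %| ((f p0)%:Z - (f' p0)%:Z) * (Q p0)%:Z)%Z.
  have -> : ((f p0)%:Z - (f' p0)%:Z) * (Q p0)%:Z =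
    - (\sum_(p in s | p != p0) ((f p)%:Z - (f' p)%:Z) * (Q p)%:Z
       + k * (\prod_(p in s) (p : nat))%:Z).
    by apply/eqP; rewrite -addr_eq0 addrA -(bigD1 p0)//= -/X X0.
  rewrite rpredN rpredD//.
    rewrite big_seq_cond; apply: rpred_sum => p /andP[_ /andP[_ pp]].
    rewrite dvdz_mull// dvdzE/= /Q (bigD1 p0) ?dvdn_mulr//.
    by rewrite p0s eq_sym.
  by rewrite dvdz_mull// dvdzE/= (QE p0 p0s) dvdn_mulr.
rewrite dvdzE abszM Euclid_dvdM//= => /orP[].
  have /andP[a b] := fs _ p0s.
  move=> /dvdn_leq; have : (f p0 : nat) != f' p0 by [].
  move: (nat_of_ord (f p0)) (nat_of_ord (f' p0)) (nat_of_ord p0) a b => x y q; lia.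
rewrite /Q Euclid_dvd_prod//.
rewrite big_has_cond => /hasP[q _ /andP[/andP[qs qp]]].
rewrite dvdn_prime2 ?sp// => /eqP e.
by rewrite -val_eqE /= -e eqxx in qp.
Qed.

End Fractions.

(** * The local sieve functions *)

Section LocalFourier.
Variables (R : realType) (p : nat) (L : {set 'Z_p}).

Definition local_density : R := #|L|%:R / (p%:R - #|L|%:R).

(** Mean zero modulo [p], and constant on the residues that survive the sieve. *)
Definition local_weight (n : int) : R :=
  if (n%:~R : 'Z_p) \in L then -1 else local_density.

Definition local_coef (a : nat) : R[i] :=
  if (0 < a < p)%N then
    (- ((1 + local_density) / p%:R))%:C
    * \sum_(l in L) cis (- (l%:R * (a%:R / p%:R)))
  else 0.

Lemma local_weight_sq n :
  local_weight n ^+ 2 = local_density + (local_density - 1) * local_weight n.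
Proof. by rewrite /local_weight; case: ifP => _; ring. Qed.

Hypothesis p_prime : prime p.
Hypothesis L_lt : (#|L| < p)%N.

Lemma local_density_ge0 : 0 <= local_density.
Proof. by rewrite divr_ge0// subr_ge0 ler_nat ltnW. Qed.

Lemma local_density_eq : (1 + local_density) * #|L|%:R / p%:R = local_density.
Proof.
have L0 : p%:R - #|L|%:R != 0 :> R by rewrite subr_eq0 eqr_nat gtn_eqF.
have P0 : p%:R != 0 :> R by rewrite pnatr_eq0 -lt0n prime_gt0.
by rewrite /local_density; field; rewrite L0.
Qed.

Lemma local_coef_le a : normc (local_coef a) <= local_density.
Proof.
rewrite /local_coef; case: ifP => _; last by rewrite normc0 local_density_ge0.
have d0 := local_density_ge0.
rewrite normcM normc_real normrN ger0_norm ?divr_ge0 ?addr_ge0//.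
rewrite -[leRHS]local_density_eq mulrAC ler_wpM2r ?invr_ge0//.
rewrite ler_wpM2l ?addr_ge0// (le_trans (ler_normc_sum _ _ _))//.
by under eq_bigr do rewrite normc_cis; rewrite sumr_const.
Qed.

Lemma sum_residues (n : int) :
  \sum_(l in L) (p %| n - (l : nat)%:Z)%Z%:R = ((n%:~R : 'Z_p) \in L)%:R :> R[i].
Proof.
have p1 := prime_gt1 p_prime.
have pc : p \in [pchar 'Z_p] by rewrite inE p_prime /= char_Zp.
have E (l : 'Z_p) : (p %| n - (l : nat)%:Z)%Z = (n%:~R == l).
  by rewrite (dvdz_pcharf pc) rmorphB /= -pmulrn natr_Zp subr_eq0.
under eq_bigr do rewrite E.
have [nL|nL] := boolP (n%:~R \in L).
  rewrite (bigD1 (n%:~R))//= eqxx big1 ?addr0// => l /andP[_].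
  by rewrite eq_sym => /negbTE ->.
rewrite big1// => l lL; case: eqP => // e.
by rewrite e lL in nL.
Qed.

(** The indicator of [L] is expanded by orthogonality of the additive
    characters; the term of frequency 0 cancels because [local_weight] has mean
    zero, which is [local_density_eq]. *)
Lemma local_weight_fourier (Z : nat) (n : int) : (p <= Z)%N ->
  (local_weight n)%:C =
  \sum_(a < Z.+1 | a != ord0) local_coef a * cis (n%:~R * (a%:R / p%:R)).
Proof.
move=> pZ; have p0 := prime_gt0 p_prime.
have P0 : p%:R != 0 :> R by rewrite pnatr_eq0 -lt0n.
pose c : R := (1 + local_density) / p%:R.
have full : \sum_(a < Z.+1 | a != ord0) local_coef a * cis (n%:~R * (a%:R / p%:R))
  = (- c)%:C * \sum_(l in L)
      (\sum_(a < p) cis ((n - (l : nat)%:Z)%:~R * (a%:R / p%:R)) - 1).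
  have inner l : \sum_(a < p) cis ((n - (l : nat)%:Z)%:~R * (a%:R / p%:R)) - 1 =
      \sum_(a < Z.+1 | (a != ord0) && (a < p)%N)
        cis ((n - (l : nat)%:Z)%:~R * (a%:R / p%:R)) :> R[i].
    rewrite (big_ord_widen Z.+1
      (fun a => cis ((n - (l : nat)%:Z)%:~R * (a%:R / p%:R)))) 1?leqW//.
    rewrite (bigD1 ord0)//= mul0r mulr0 cis0 addrAC subrr add0r.
    by apply: eq_bigl => a; rewrite andbC.
  under [in RHS]eq_bigr => l _ do rewrite inner.
  rewrite exchange_big /= mulr_sumr [RHS]big_mkcondr /=.
  apply: eq_bigr => a a0; rewrite /local_coef lt0n.
  have -> : (nat_of_ord a != 0)%N by [].
  rewrite /=; case: ifP => _; last by rewrite mul0r.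
  rewrite -mulrA mulr_suml; congr (_ * _); apply: eq_bigr => l _.
  by rewrite -cisD; congr cis; rewrite rmorphB /= -pmulrn; ring.
rewrite full sumrB sumr_const.
under eq_bigr do rewrite sum_cis_frac// natrM.
rewrite -mulr_suml sum_residues -!(rmorph_nat (@real_complex R)).
rewrite -rmorphM -rmorphB -rmorphM /=; congr (_%:C).
have := local_density_eq; rewrite /local_weight /c.
have e : (1 + local_density) / p%:R * p%:R = 1 + local_density by rewrite mulfVK.
case: ifP => _ eL; rewrite mulNr mulrBr ?mul1r ?mul0r ?mulr0 ?e; rewrite mulrAC eL; ring.
Qed.

End LocalFourier.

(** * The sums [G] and [V] *)

Lemma fsbig_bounded (T : Type) (idx : T) (op : Monoid.com_law idx) (n : nat)
    (A : set nat) (F : nat -> T) : (forall i, A i -> (i < n)%N) ->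
  \big[op/idx]_(i \in A) F i = \big[op/idx]_(i < n | (i : nat) \in A) F i.
Proof.
move=> An; pose r := [seq i <- index_iota 0 n | i \in A].
have -> : A = [set` r].
  apply/seteqP; split=> i /=; rewrite mem_filter mem_index_iota.
    by move=> Ai; rewrite An// andbT mem_set.
  by move=> /andP[/set_mem].
rewrite -fsbig_seq ?filter_uniq ?iota_uniq// big_filter.
rewrite (big_mkord (fun i => i \in A)); apply: eq_bigl => i.
congr (_ : bool); apply/idP/idP => iA; apply: mem_set => /=.
  by rewrite mem_filter iA mem_index_iota ltn_ord.
by move: iA => /set_mem /=; rewrite mem_filter => /andP[/set_mem].
Qed.

Lemma big_primes (T : Type) (idx : T) (op : Monoid.com_law idx) (Z m : nat)
    (F : nat -> T) : (0 < m <= Z)%N ->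
  \big[op/idx]_(p <- primes m) F p
  = \big[op/idx]_(p < Z.+1 | (p : nat) \in primes m) F p.
Proof.
move=> /andP[m0 mZ]; rewrite -(big_mkord (fun p => p \in primes m)) -[RHS]big_filter.
apply: perm_big; apply: uniq_perm; rewrite ?primes_uniq ?filter_uniq ?iota_uniq//.
move=> p; rewrite mem_filter mem_index_iota /= ltnS; case: (boolP (_ \in _)) => //.
rewrite mem_primes => /and3P[_ _ pm]; apply/esym.
exact: leq_trans (dvdn_leq m0 pm) mZ.
Qed.

Lemma squarefree_logn m p : squarefree m -> logn p m = (p \in primes m).
Proof.
move=> /andP[m0 /allP sq]; case: (boolP (p \in primes m)) => [/sq/eqP//|].
by rewrite -logn_gt0 lt0n negbK => /eqP.
Qed.

Lemma squarefree_prod m : squarefree m -> (\prod_(p <- primes m) p = m)%N.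
Proof.
move=> sq; have /andP[m0 _] := sq.
rewrite {2}[m]prod_prime_decomp// prime_decompE big_map /= big_seq [RHS]big_seq.
by apply: eq_bigr => p pm; rewrite squarefree_logn// pm expn1.
Qed.

Lemma squarefree_inj m n : squarefree m -> squarefree n ->
  primes m =i primes n -> m = n.
Proof.
move=> sm sn e; have /andP[m0 _] := sm; have /andP[n0 _] := sn.
by apply: eqn_from_log => // p; rewrite !squarefree_logn// e.
Qed.

Section SieveSums.
Variables (R : realType) (P : set nat) (L : forall p : nat, {set 'Z_p}).
Variables (y z : R) (Z : nat).

Definition large_prime (p : nat) : bool := [&& p \in P, y <= p%:R & p%:R < z].

Definition large_density (p : 'I_Z.+1) : R :=
  if large_prime p then local_density R (L p) else 0.

(** The sets of large sieving primes with product at most [z], that is, the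
    squarefree levels of the sieve weight. *)
Definition level_sets : {set {set 'I_Z.+1}} :=
  [set A : {set 'I_Z.+1} | ((\prod_(p in A) (p : nat))%:R <= z)
    && [forall (p | p \in A), large_prime p]]%SET.

Lemma level_setsP (A : {set 'I_Z.+1}) :
  reflect ((\prod_(p in A) (p : nat))%:R <= z /\ forall p, p \in A -> large_prime p)
          (A \in level_sets).
Proof.
rewrite inE; apply: (iffP andP) => -[hA lA]; split=> //.
  by move=> p pA; move/forallP: lA => /(_ p); rewrite pA.
by apply/forallP => p; apply/implyP; exact: lA.
Qed.

Hypothesis data : sieve_data P L.
Hypothesis z_ge1 : 1 <= z.

Lemma P_prime p : p \in P -> prime p.
Proof. by move=> /set_mem; case: data => _ + _; exact. Qed.

Lemma card_lt p : p \in P -> (#|L p| < p)%N.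
Proof.
move=> pP; have pp := P_prime pP; case: data => _ _ /(_ p (set_mem pP))[_].
by move=> /proper_card /leq_trans; apply; rewrite cardsT card_ord Zp_cast ?prime_gt1.
Qed.

Lemma density_ge0 p : p \in P -> 0 <= local_density R (L p).
Proof. by move=> pP; apply: local_density_ge0; rewrite card_lt. Qed.

Lemma large_density_ge0 p : 0 <= large_density p.
Proof.
by rewrite /large_density; case: ifP => // /and3P[pP _ _]; exact: density_ge0.
Qed.

Lemma set0_level : finset.set0 \in level_sets.
Proof.
by apply/level_setsP; split=> [|p]; rewrite ?big_set0 ?inE.
Qed.

Lemma level_sets_down (A E : {set 'I_Z.+1}) :
  A \in level_sets -> E \subset A -> E \in level_sets.
Proof.
move=> /level_setsP[Az lA] EA; apply/level_setsP; split; last first.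
  by move=> p pE; apply: lA; apply: (fintype.subsetP _) p pE.
apply: le_trans Az; rewrite ler_nat [leqRHS](big_setID E) /= (finset.setIidPr EA) leq_pmulr//.
rewrite prodn_cond_gt0// => p; rewrite inE => /andP[_ /lA /and3P[pP _ _]].
by rewrite prime_gt0 ?P_prime.
Qed.

Lemma weight_sum_ge1 : 1 <= weight_sum level_sets large_density.
Proof.
rewrite /weight_sum (bigD1 finset.set0) ?set0_level//= big_set0 lerDl sumr_ge0//.
by move=> A _; apply: prodr_ge0 => p _; exact: large_density_ge0.
Qed.

Definition small_density (p : nat) : R :=
  if (p \in P) && (p%:R < y) then local_density R (L p) else 0.

Lemma small_density_ge0 p : 0 <= small_density p.
Proof. by rewrite /small_density; case: ifP => // /andP[pP _]; exact: density_ge0. Qed.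

(** Each factor of [V] is [1 + lambda / (p - lambda)]. *)
Lemma sieve_V_expand : y <= Z%:R ->
  sieve_V P L y = \sum_(E : {set 'I_Z.+1}) \prod_(p in E) small_density p.
Proof.
move=> yZ; rewrite /sieve_V (@fsbig_bounded _ _ _ Z.+1) => [|p [_ py]]; last first.
  by rewrite -(ltr_nat R) (lt_trans py)// (le_lt_trans yZ)// ltr_nat.
transitivity (\prod_(p < Z.+1) (small_density p + 1)).
  rewrite big_mkcond; apply: eq_bigr => p _; rewrite /small_density.
  case: ifPn => [/set_mem [Pp py]|np]; last first.
    case: ifP => [/andP[pP py]|_]; last by rewrite add0r.
    by rewrite mem_set in np => //; split=> //; exact: set_mem.
  have pP : (p : nat) \in P by rewrite mem_set.
  rewrite pP py /= /local_density; have := card_lt pP.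
  rewrite -(ltr_nat R) => h.
  have P0 : (p%:R : R) != 0 by rewrite gt_eqF// (le_lt_trans _ h).
  by field; rewrite P0 subr_eq0 gt_eqF.
rewrite bigA_distr /=; apply: eq_bigr => E _.
by rewrite [RHS]big_mkcond.
Qed.

Lemma sieve_V_ge1 : y <= Z%:R -> 1 <= sieve_V P L y.
Proof.
move=> yZ; rewrite (sieve_V_expand yZ) (bigD1 finset.set0)//= big_set0 lerDl.
by apply: sumr_ge0 => E _; apply: prodr_ge0 => p _; exact: small_density_ge0.
Qed.

Hypothesis density_le2 : forall p, p \in P -> y <= p%:R -> local_density R (L p) <= 2.

(** A squarefree [m <= z] is determined by its prime factors below [y], which
    give a term of [V], and those above [y], which form a level set.  The level
    sets only contain primes below [z], so [m = z] prime escapes; its density is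
    at most 2, which accounts for the factor 3. *)
Lemma sieve_G_le : z <= Z%:R -> y <= Z%:R ->
  sieve_G P L z <= 3 * sieve_V P L y * weight_sum level_sets large_density.
Proof.
move=> zZ yZ; have V1 := sieve_V_ge1 yZ; have W1 := weight_sum_ge1.
rewrite /sieve_G (@fsbig_bounded _ _ _ Z.+1) => [|m [_ mz]]; last first.
  by rewrite ltnS -(ler_nat R) (le_trans mz).
pose good m := squarefree m && all (fun p => p \in P) (primes m).
pose edge (m : nat) := has (fun p => (y <= p%:R) && (z <= p%:R)) (primes m).
have hE m : sieve_h R P L m =
    if good m then \prod_(p <- primes m) local_density R (L p) else 0.
  rewrite /sieve_h /good; case: ifP => //= sq; case: ifPn => [/allP mP|/allPn[p pm pP]].
    by rewrite big_seq [RHS]big_seq; apply: eq_bigr => p /mP ->.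
  by apply/eqP; rewrite prodf_seq_eq0; apply/hasP; exists p => //; rewrite (negbTE pP) /=.
pose ok m := (m \in [set m : nat | (0 < m)%N /\ m%:R <= z]) && good m.
rewrite -(big_mkord (fun m => m \in [set m : nat | (0 < m)%N /\ m%:R <= z])
  (sieve_h R P L)).
under eq_bigr do rewrite hE.
rewrite -big_mkcondr (bigID edge)/=.
have okP m : ok m -> [/\ (0 < m <= Z)%N, m%:R <= z, squarefree m &
    {in primes m, forall p, p \in P}].
  move=> /andP[/set_mem[m0 mz] /andP[sq /allP mP]]; split=> //.
  by rewrite m0 -(ler_nat R) (le_trans mz).
have edgeE m : ok m -> edge m -> m%:R = z /\ \prod_(p <- primes m) local_density R (L p) <= 2.
  move=> /okP[/andP[m0 mZ] mz sq mP] /hasP[p pm /andP[yp zp]].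
  have pp := P_prime (mP _ pm).
  have pmle : (p <= m)%N by apply: dvdn_leq => //; move: pm; rewrite mem_primes => /and3P[].
  have mp : m = p.
    by apply/eqP; rewrite eqn_leq pmle andbT -(ler_nat R) (le_trans mz).
  split; first by apply/eqP; rewrite eq_le mz/= mp.
  by rewrite mp primes_prime// big_seq1 density_le2// mP.
have edges : \sum_(0 <= m < Z.+1 | ok m && edge m)
    \prod_(p <- primes m) local_density R (L p) <= 2.
  rewrite -big_filter -[leRHS](big_seq1 +%R tt (fun=> 2)).
  apply: (@ler_sum_inj R nat unit _ [:: tt] (fun=> tt)) => //.
  - by rewrite filter_uniq// iota_uniq.
  - move=> a b; rewrite !mem_filter => /andP[/andP[oa ea] _] /andP[/andP[ob eb] _] _.
    have [az _] := edgeE a oa ea; have [bz _] := edgeE b ob eb.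
    by apply/eqP; rewrite -(eqr_nat R) az bz.
  - by move=> m; rewrite mem_filter => /andP[/andP[om em] _]; case: (edgeE m om em).
pose Es (m : nat) : {set 'I_Z.+1} :=
  [set p : 'I_Z.+1 | ((p : nat) \in primes m) && (p%:R < y)]%SET.
pose As (m : nat) : {set 'I_Z.+1} :=
  [set p : 'I_Z.+1 | ((p : nat) \in primes m) && (y <= p%:R)]%SET.
have regular : \sum_(0 <= m < Z.+1 | ok m && ~~ edge m)
    \prod_(p <- primes m) local_density R (L p) <=
    sieve_V P L y * weight_sum level_sets large_density.
  rewrite (sieve_V_expand yZ) /weight_sum big_distrlr /= pair_big_dep /=.
  rewrite -big_filter -[leRHS]big_filter.
  apply: (@ler_sum_inj R _ _ _ _ (fun m => (Es m, As m))).
  - by rewrite filter_uniq// iota_uniq.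
  - move=> a b; rewrite !mem_filter => /andP[/andP[oa _] _] /andP[/andP[ob _] _].
    have [aZ _ sa _] := okP a oa; have [bZ _ sb _] := okP b ob.
    move=> [e1 e2]; apply: squarefree_inj => // p.
    have pz c : (0 < c <= Z)%N -> p \in primes c -> (p < Z.+1)%N.
      move=> /andP[c0 cZ]; rewrite mem_primes => /and3P[_ _ pc].
      by rewrite ltnS (leq_trans (dvdn_leq c0 pc)).
    have main (pZ : (p < Z.+1)%N) : (p \in primes a) = (p \in primes b).
      move/setP: e1 => /(_ (Ordinal pZ)); move/setP: e2 => /(_ (Ordinal pZ)).
      rewrite !inE /= ltNge; case: (y <= p%:R); rewrite ?andbT ?andbF//.
    by apply/idP/idP => pc; [rewrite -main ?(pz a)|rewrite main ?(pz b)].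
  - move=> m; rewrite !mem_filter !mem_index_enum /= andbT => /andP[/andP[om /hasPn ne] _].
    have [mZ mz sq mP] := okP m om.
    apply/level_setsP; split.
      apply: le_trans mz; rewrite ler_nat.
      have -> : (\prod_(p in As m) (p : nat) =
          \prod_(p < Z.+1 | ((p : nat) \in primes m) && (y <= p%:R)%R) (p : nat))%N.
        by apply: eq_bigl => p; rewrite inE.
      rewrite -[leqRHS](squarefree_prod sq) (big_primes _ _ mZ).
      rewrite [leqRHS](bigID (fun p : 'I_Z.+1 => y <= p%:R)) /=.
      by rewrite leq_pmulr// prodn_cond_gt0// => p /andP[/mP /P_prime /prime_gt0].
    move=> p; rewrite inE => /andP[pm yp]; rewrite /large_prime mP// yp /=.
    by have := ne _ pm; rewrite yp /= -ltNge.
  - move=> [E A] _ /=; apply: mulr_ge0; apply: prodr_ge0 => p _.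
      exact: small_density_ge0.
    exact: large_density_ge0.
  - move=> m; rewrite mem_filter => /andP[/andP[om /hasPn ne] _] /=.
    have [mZ mz sq mP] := okP m om.
    rewrite (big_primes _ _ mZ) (bigID (fun p : 'I_Z.+1 => p%:R < y)) /=.
    rewrite le_eqVlt; apply/orP; left; apply/eqP; congr (_ * _).
      apply: eq_big => [p|p /andP[pm py]]; first by rewrite inE.
      by rewrite /small_density mP// py.
    apply: eq_big => [p|p /andP[pm]]; first by rewrite inE -leNgt.
    rewrite -leNgt => yp; rewrite /large_density /large_prime mP// yp /=.
    by have := ne _ pm; rewrite yp /= -ltNge => ->.
have := lerD edges regular; rewrite /ok => /le_trans; apply.
by move: (sieve_V P L y) (weight_sum _ _) V1 W1 => V W V1 W1; nra.
Qed.

End SieveSums.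

(** * Points of the circle *)

Section Circle.
Variable R : realType.
Implicit Types b : circle R.

Lemma circle_piD (r r' : R) :
  \pi_(circle R) (r + r') = \pi_(circle R) r + \pi_(circle R) r'.
Proof. exact: (@Quotient.pi_add R (GRing.ZmodClosed.clone R (@Num.int_num_subdef R) _)). Qed.

Lemma circle_piN (r : R) : \pi_(circle R) (- r) = - \pi_(circle R) r.
Proof. exact: (@Quotient.pi_opp R (GRing.ZmodClosed.clone R (@Num.int_num_subdef R) _)). Qed.

Lemma circle_reprB b b' : b - b' = \pi_(circle R) (repr b - repr b').
Proof. by rewrite circle_piD circle_piN !reprK. Qed.

Lemma circle_reprMn b n : b *+ n = \pi_(circle R) (repr b *+ n).
Proof.
elim: n => [|n IH]; last by rewrite !mulrS circle_piD reprK IH.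
by apply: (addIr (\pi_(circle R) 0)); rewrite -circle_piD !mulr0n !add0r.
Qed.

Lemma circle_e_repr b n : circle_e (b *+ n) = cis (repr b *+ n).
Proof. by rewrite circle_reprMn circle_e_pi. Qed.

Lemma well_spaced_repr (delta : R) (B : {fset circle R}) : well_spaced delta B ->
  {in B &, forall b b', b != b' -> forall k : int,
     delta <= `|repr b - repr b' + k%:~R|}.
Proof.
move=> sp b b' bB b'B bb' k; apply: le_trans (sp _ _ bB b'B bb') _.
rewrite circle_reprB circle_norm_pi; apply: ge_inf; last by exists k.
by exists 0 => _ [j _ <-].
Qed.

End Circle.

(** * The large sieve for a sifted set *)

Lemma prodn_setU_le (I : finType) (A B : {set I}) (F : I -> nat) :
  (forall p, p \in A :|: B -> 0 < F p)%N ->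
  (\prod_(p in A :|: B) F p <= (\prod_(p in A) F p) * \prod_(p in B) F p)%N.
Proof.
move=> F0; rewrite [leqLHS](big_setID A) /= finset.setUK leq_mul2l; apply/orP; right.
rewrite [leqRHS](big_setID A) /= finset.setDUl finset.setDv finset.set0U leq_pmull//.
rewrite prodn_cond_gt0// => p; rewrite inE => /andP[pB _].
by apply: F0; rewrite inE pB orbT.
Qed.

Section Sifted.
Variables (R : realType) (P : set nat) (L : forall p : nat, {set 'Z_p}).
Variables (y z N : R) (Z : nat).
Hypothesis data : sieve_data P L.
Hypothesis z_ge1 : 1 <= z.
Hypothesis zN : z ^+ 4 <= N.
Hypothesis density_le2 : forall p, p \in P -> y <= p%:R -> local_density R (L p) <= 2.

Local Notation D := (level_sets P y z Z).
Local Notation h := (@large_density R P L y z Z).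
Local Notation W := (weight_sum D h).

Definition large_weight (p : 'I_Z.+1) (n : int) : R :=
  if large_prime P y z p then local_weight R (L p) n else 0.

Definition large_coef (p a : 'I_Z.+1) : R[i] :=
  if large_prime P y z p then local_coef R (L p) a else 0.

Local Notation w := (weight_coef D h large_coef).

Lemma large_prime_prime (p : nat) : large_prime P y z p -> prime p.
Proof. by move=> /and3P[pP _ _]; exact: (P_prime data pP). Qed.

Lemma large_weight_sq p n :
  large_weight p n ^+ 2 = h p + (h p - 1) * large_weight p n.
Proof.
rewrite /large_weight /large_density; case: ifP => _; first exact: local_weight_sq.
by rewrite expr0n mulr0 addr0.
Qed.

Lemma large_weight_fourier p n : (large_weight p n)%:C =
  \sum_(a : 'I_Z.+1 | a != ord0) large_coef p a * cis (n%:~R * (a%:R / p%:R)).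
Proof.
rewrite /large_weight /large_coef; case: ifPn => lp; last first.
  by rewrite big1// => a _; rewrite mul0r.
have /and3P[pP _ _] := lp.
apply: local_weight_fourier; [exact: large_prime_prime lp| |].
  exact: (card_lt data pP).
by rewrite -ltnS.
Qed.

Lemma large_density_le2 p : h p <= 2.
Proof.
by rewrite /large_density; case: ifP => // /and3P[pP yp _]; exact: density_le2.
Qed.

Lemma large_coef_le p a : normc (large_coef p a) <= h p.
Proof.
rewrite /large_coef /large_density; case: ifPn => lp; last by rewrite normc0.
have /and3P[pP _ _] := lp.
apply: local_coef_le; [exact: large_prime_prime lp|exact: (card_lt data pP)].
Qed.

(** A frequency with nonzero coefficient is supported on the union of two level
    sets, so that two of them have a common denominator at most [z ^ 4]. *)
Lemma large_freq_spaced (f f' : {ffun 'I_Z.+1 -> 'I_Z.+1}) (k : int) :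
  w f != 0 -> w f' != 0 -> f != f' ->
  N^-1 <= `|frac_freq R f - frac_freq R f' + k%:~R|.
Proof.
move=> /weight_coef_neq0[A1 [A2 [D1 D2 hf]]] /weight_coef_neq0[A3 [A4 [D3 D4 hf']]].
move=> ff'; pose s := (A1 :|: A2) :|: (A3 :|: A4).
have Dl A : A \in D -> forall p : 'I_Z.+1, p \in A -> large_prime P y z p.
  by move=> /level_setsP[].
have Dz A : A \in D -> (\prod_(p in A) (p : nat))%:R <= z by move=> /level_setsP[].
have sl p : p \in s -> large_prime P y z p.
  by rewrite !inE => /orP[/orP[]|/orP[]]; apply: Dl.
have sp p : p \in s -> prime p by move=> /sl; exact: large_prime_prime.
have supp (g : {ffun 'I_Z.+1 -> 'I_Z.+1}) (A A' : {set 'I_Z.+1}) :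
    A :|: A' \subset s ->
    (forall p, g p != ord0 -> (p \in A :|: A') && (large_coef p (g p) != 0)) ->
    (forall p, p \in s -> (g p < p)%N) /\ (forall p, p \notin s -> g p == ord0).
  move=> sub hg; split=> p ps; last first.
    apply: contraNT ps => /hg /andP[pA _]; exact: (fintype.subsetP sub).
  have [->|/hg/andP[_]] := eqVneq (g p) ord0; first by rewrite prime_gt0 ?sp.
  rewrite /large_coef sl// /local_coef; case: ifP => [/andP[] //|].
  by rewrite eqxx.
have [fs fns] := supp f A1 A2 (finset.subsetUl _ _) hf.
have [fs' fns'] := supp f' A3 A4 (finset.subsetUr _ _) hf'.
have N0 : 0 < N by rewrite (lt_le_trans _ zN)// exprn_gt0// (lt_le_trans _ z_ge1).
rewrite -[leLHS]mul1r ler_pdivrMr//.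
apply: le_trans (@frac_freq_spaced R Z s f f' k sp _ _ ff') _.
- by move=> p ps; rewrite fs ?fs'.
- by move=> p ps; rewrite fns ?fns'.
rewrite mulrC ler_wpM2l//; apply: le_trans zN.
have z0 : 0 <= z by rewrite (le_trans _ z_ge1).
have two A A' : A \in D -> A' \in D -> A :|: A' \subset s ->
    (\prod_(p in A :|: A') (p : nat))%:R <= z * z.
  move=> DA DA' sub; apply: (@le_trans _ _
    ((\prod_(p in A) (p : nat)) * \prod_(p in A') (p : nat))%N%:R).
    rewrite ler_nat prodn_setU_le// => p pA.
    by rewrite prime_gt0// sp//; exact: (fintype.subsetP sub).
  by rewrite natrM ler_pM// Dz.
have -> : z ^+ 4 = (z * z) * (z * z) by ring.
apply: (@le_trans _ _ ((\prod_(p in A1 :|: A2) (p : nat)) *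
    \prod_(p in A3 :|: A4) (p : nat))%N%:R).
  by rewrite ler_nat prodn_setU_le// => p ps; rewrite prime_gt0// sp.
by rewrite natrM ler_pM// two// ?finset.subsetUl ?finset.subsetUr.
Qed.

Lemma weight_sq_sifted (n : nat) : sifted_set P L z N n ->
  weight_sq D large_weight n%:Z = W ^+ 2.
Proof.
move=> [_ _ nS]; congr (_ ^+ 2); apply: eq_bigr => A /level_setsP[_ lA].
apply: eq_bigr => p /lA lp; rewrite /large_weight /large_density lp /local_weight.
have /and3P[/set_mem pP _ pz] := lp.
by rewrite -pmulrn (negbTE (nS _ pP pz)).
Qed.

(** The zero frequency uses the spacing of the points [t].  Each of the other
    coefficients is at most [W / size s], which compensates the [size s] values
    of [b], and their frequencies are [1 / N]-spaced. *)
Lemma fourier_row_le (I : eqType) (s : seq I) (t : I -> R) (delta : R) (m : nat) :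
  (0 < m)%N -> m%:R <= 2 * N -> uniq s -> 0 < delta -> (0 < size s)%N ->
  {in s &, forall i j, i != j -> forall k : int, delta <= `|t i - t j + k%:~R|} ->
  (forall p, p \in P -> y <= p%:R -> 4 * local_density R (L p) <= (size s)%:R^-1) ->
  \sum_(b <- s) \sum_f normc (w f) * fejer m (t b + frac_freq R f)
    <= 60 * (N + delta^-1) * W.
Proof.
move=> m0 mN us d0 s0 sp small.
have N0 : 0 < N by rewrite (lt_le_trans _ zN)// exprn_gt0// (lt_le_trans _ z_ge1).
have W0 : 0 <= W.
  by rewrite (le_trans _ (weight_sum_ge1 y Z data z_ge1)).
have S0 : 0 < (size s)%:R :> R by rewrite ltr0n.
have h0 p : 0 <= h p by apply: (@large_density_ge0 R P L y z Z data).
pose f0 : {ffun 'I_Z.+1 -> 'I_Z.+1} := [ffun=> ord0].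
have coef f : f != f0 -> normc (w f) <= W * (size s)%:R^-1.
  move=> ff0; apply: le_trans (weight_coef_le _ _ _ _ f) _.
  - exact: h0.
  - exact: large_density_le2.
  - exact: large_coef_le.
  - by move=> A E; exact: (level_sets_down data).
  rewrite ler_wpM2l//.
  have [p fp] := neq_ffun_ex ff0; rewrite ffunE in fp.
  have h1 q : 4 * h q <= (size s)%:R^-1.
    rewrite /large_density; case: ifP => [/and3P[qP yq _]|_]; first exact: small.
    by rewrite mulr0 invr_ge0.
  rewrite (bigD1 p)//= -[leRHS]mulr1 ler_pM//.
  - by rewrite mulr_ge0// h0.
  - by apply: prodr_ge0 => q _; rewrite mulr_ge0// h0.
  - apply: prodr_ile1 => q _; rewrite mulr_ge0 ?h0//=.
    by apply: le_trans (h1 q) _; rewrite invf_le1// ler1n.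
have head : \sum_(b <- s) normc (w f0) * fejer m (t b + frac_freq R f0)
    <= W * (12 * (m%:R + delta^-1)).
  rewrite weight_coef0 normc_real ger0_norm// -mulr_sumr ler_wpM2l//.
  apply: (fejer_sum_spaced us d0 m0) => i j si sj ij k.
  by rewrite opprD addrACA subrr addr0; exact: sp.
have tail b : \sum_(f | f != f0) normc (w f) * fejer m (t b + frac_freq R f)
    <= W * (size s)%:R^-1 * (12 * (m%:R + N)).
  apply: (@le_trans _ _ (\sum_(f | (f != f0) && (w f != 0))
      W * (size s)%:R^-1 * fejer m (t b + frac_freq R f))).
    rewrite [leRHS]big_mkcondr; apply: ler_sum => f ff0; case: ifPn => [_|].
      by rewrite ler_wpM2r ?fejer_ge0// coef.
    by rewrite negbK => /eqP ->; rewrite normc0 mul0r.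
  rewrite -mulr_sumr ler_wpM2l ?mulr_ge0 ?invr_ge0//.
  rewrite -big_filter -[N in leRHS]invrK.
  apply: fejer_sum_spaced; rewrite ?filter_uniq ?index_enum_uniq ?invr_gt0//.
  move=> f f'; rewrite !mem_filter => /andP[/andP[_ wf] _] /andP[/andP[_ wf'] _] ff' k.
  by rewrite opprD addrACA subrr add0r; exact: large_freq_spaced.
under eq_bigr do rewrite (bigD1 f0)//=.
rewrite big_split /=; apply: le_trans (lerD head (ler_sum _ (fun b _ => tail b))) _.
rewrite big_const_seq count_predT iter_addr_0 -[_ *+ size s]mulr_natl.
have -> : (size s)%:R * (W * (size s)%:R^-1 * (12 * (m%:R + N))) = W * (12 * (m%:R + N)).
  by field; rewrite gt_eqF.
rewrite -mulrDr mulrC ler_wpM2r//.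
have := invr_gt0 delta; rewrite d0 => di0; lra.
Qed.

(** The saving over the plain large sieve is the full [weight_sum], without any
    loss, provided that the sieving primes are large compared with the number of
    points. *)
Lemma sifted_large_sieve (I : eqType) (s : seq I) (x : I -> R) (delta : R)
    (m : nat) (a : nat -> R[i]) :
  (0 < m)%N -> m%:R <= 2 * N -> uniq s -> 0 < delta -> (0 < size s)%N ->
  {in s &, forall i j, i != j -> forall k : int, delta <= `|x i - x j + k%:~R|} ->
  (forall p, p \in P -> y <= p%:R -> 4 * local_density R (L p) <= (size s)%:R^-1) ->
  \sum_(b <- s)
     normc (\sum_(n < m | (n : nat) \in sifted_set P L z N) a n * cis (x b *+ n)) ^+ 2
  <= 60 * (N + delta^-1) / W *
     \sum_(n < m | (n : nat) \in sifted_set P L z N) normc (a n) ^+ 2.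
Proof.
move=> m0 mN us d0 s0 sp small.
have N0 : 0 < N by rewrite (lt_le_trans _ zN)// exprn_gt0// (lt_le_trans _ z_ge1).
have W0 : 0 < W.
  by rewrite (lt_le_trans _ (weight_sum_ge1 y Z data z_ge1)).
have -> : 60 * (N + delta^-1) / W = 60 * (N + delta^-1) * W / W ^+ 2.
  by field; rewrite !gt_eqF.
apply: (@large_sieve_of_majorant R I s x _ w (@frac_freq R Z) m _ _
  (weight_sq D large_weight) (fun n => n \in sifted_set P L z N)) => //.
- by rewrite !mulr_gt0// addr_gt0// invr_gt0.
- by rewrite exprn_gt0.
- by move=> n; exact: sqr_ge0.
- by move=> n /set_mem /weight_sq_sifted ->.
- by move=> n; apply: weight_sq_fourier; [exact: large_weight_sq|exact: large_weight_fourier].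
- move=> b sb; apply: fourier_row_le => // i j si sj ij k.
  have -> : x b - x i - (x b - x j) + k%:~R = x j - x i + k%:~R by ring.
  by apply: sp => //; rewrite eq_sym.
- move=> b sb; apply: fourier_row_le => // i j si sj ij k.
  have -> : x i - x b - (x j - x b) + k%:~R = x i - x j + k%:~R by ring.
  exact: sp.
Qed.

End Sifted.

(** * Choice of the threshold *)

Section Threshold.
Variable R : realType.

Lemma sieve_G_gt0 (P : set nat) (L : forall p : nat, {set 'Z_p}) (z : R) :
  sieve_data P L -> 1 <= z -> 0 < sieve_G P L z.
Proof.
move=> data z1; pose Z := (Num.truncn z).+1.
have zZ : z < Z%:R by exact: truncnS_gt.
rewrite /sieve_G (@fsbig_bounded _ _ _ Z) => [|m [_ mz]]; last first.
  by rewrite -(ltr_nat R) (le_lt_trans mz).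
have Z1 : (1 < Z)%N by rewrite -(ltr_nat R) (le_lt_trans z1).
rewrite (bigD1 (Ordinal Z1)) /=; last by rewrite mem_set.
apply: ltr_pwDl; first by rewrite /sieve_h /squarefree /= big_nil ltr01.
apply: sumr_ge0 => m _; rewrite /sieve_h; case: ifP => // _.
apply: prodr_ge0 => p _; case: ifP => // pP.
by have := density_ge0 R data pP.
Qed.

(** With [r = p^(1/4)], so that [r^2 >= c * beta], the density is at most about
    [M r / r^4], hence at most a multiple of [M / (c * beta)]. *)
Lemma density_small (M c beta p lam : R) : 0 < M -> 1 <= beta -> 1 <= p ->
  8 * M <= c -> (c * beta) ^+ 2 <= p -> 1 <= c -> 0 <= lam -> lam < p ->
  lam <= M * p `^ 4^-1 -> 4 * (lam / (p - lam)) <= beta^-1.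
Proof.
move=> M0 b1 p1 cM yp c1 l0 lp lM.
have p0 : 0 < p by lra.
set r := p `^ 4^-1.
have r0 : 0 <= r by exact: powR_ge0.
have r4 : r ^+ 4 = p.
  rewrite -powR_mulrn// -powRrM mulVf// powRr1// ltW//.
have b0 : 0 < beta by lra.
have r1 : 1 <= r.
  by rewrite leNgt; apply/negP => rl; have := exprn_ilt1 4 r0 rl; rewrite r4/=; lra.
have r2 : c * beta <= r ^+ 2.
  rewrite -(@ler_pXn2r _ 2) ?nnegrE ?sqr_ge0 ?mulr_ge0 ?(ltW b0)//; last lra.
  by rewrite -exprM r4.
rewrite mulrA ler_pdivrMr ?subr_gt0// [leRHS]mulrC ler_pdivlMr//.
have h1 : 8 * M * beta <= r ^+ 2 by rewrite (le_trans _ r2)// ler_wpM2r// ltW.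
have h2 : 8 * lam * beta <= r ^+ 2 * r.
  apply: le_trans (_ : 8 * (M * r) * beta <= _).
    by rewrite ler_wpM2r ?(ltW b0)// ler_wpM2l.
  have -> : 8 * (M * r) * beta = (8 * M * beta) * r by ring.
  exact: (ler_wpM2r r0).
have h3 : r ^+ 2 * r <= p.
  by rewrite -r4 -exprSr ler_weXn2l.
nra.
Qed.

(** As [beta >= 1], both [ln c] and [ln beta] are at most constant multiples of
    [ln (2 * beta)];
    the factor 2 keeps the latter away from 0 when [beta = 1]. *)
Lemma ln_level_le (c beta : R) : 2 <= c -> 1 <= beta ->
  ln ((c * beta) ^+ 2) <= 2 * (ln c / ln 2 + 1) * ln (2 * beta).
Proof.
move=> c2 b1.
have l2 : 0 < ln 2 :> R by rewrite ln_gt0// ltr1n.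
have c0 : 0 < c by lra. have b0 : 0 < beta by lra.
rewrite lnXn ?mulr_gt0// !lnM ?posrE//.
have lb : 0 <= ln beta by rewrite ln_ge0.
have lc : 0 <= ln c by rewrite ln_ge0//; lra.
have q0 : 0 <= ln c / ln 2 by rewrite divr_ge0// ltW.
have e : ln c / ln 2 * ln 2 = ln c by rewrite mulfVK// gt_eqF.
have q1 : 0 <= ln c / ln 2 * ln beta by rewrite mulr_ge0.
have -> : 2 * (ln c / ln 2 + 1) * (ln 2 + ln beta) =
    2 * (ln c / ln 2 * ln 2 + ln c / ln 2 * ln beta + ln 2 + ln beta) by ring.
by rewrite e -[_ *+ 2]mulr_natl; lra.
Qed.

End Threshold.

Theorem theorem1p4 (R : realType) (kappa T M : R)
    (hkappa : 0 < kappa) (hT : 0 < T) (hM : 0 < M) :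
  exists K : R,
    forall (P : set nat) (L : forall p : nat, {set 'Z_p}),
      sieve_data P L ->
      (forall p, P p -> #|L p|%:R <= M * p%:R `^ 4^-1) ->
      (forall y : R, 2 <= y -> sieve_V P L y <= T * ln y `^ kappa) ->
    forall N z : R, 0 < N -> 1 <= z -> z <= N `^ 4^-1 ->
    forall (delta : R) (B : {fset circle R}),
      0 < delta -> B != fset0 -> well_spaced delta B ->
    forall a : nat -> R[i],
      \sum_(b <- B)
        ComplexField.Normc.normc
          (\sum_(n \in sifted_set P L z N) a n * circle_e (b *+ n)) ^+ 2
      <= K * ((N + delta^-1) / sieve_G P L z)
           * ln (2 * #|` B|%:R) `^ kappa
           * \sum_(n \in sifted_set P L z N) ComplexField.Normc.normc (a n) ^+ 2.
Proof.
pose c := 8 * M + 2; pose C := 2 * (ln c / ln 2 + 1).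
exists (180 * T * C `^ kappa) => P L data lamM VT N z N0 z1 zN delta B d0 B0 spB a.
have z0 : 0 <= z by lra.
have z4N : z ^+ 4 <= N.
  have : z ^+ 4 <= (N `^ 4^-1) ^+ 4 by rewrite ler_pXn2r ?nnegrE ?powR_ge0.
  by rewrite -[X in _ <= X]powR_mulrn ?powR_ge0// -powRrM mulVf// powRr1// ltW.
have N1 : 1 <= N by rewrite (le_trans _ z4N)// exprn_ege1.
pose beta : R := #|` B|%:R.
have sB0 : (0 < size B)%N by rewrite cardfs_gt0.
have b1 : 1 <= beta by rewrite /beta ler1n.
have c2 : 2 <= c by rewrite /c; lra.
(* The exponent 2 matches [lambda (p) <= M p^(1/4)]: it makes [h] at most
   [1 / (4 |B|)] beyond [y]. *)
pose y := (c * beta) ^+ 2.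
have cb2 : 2 <= c * beta by nra.
have y2 : 2 <= y by rewrite /y expr2; nra.
have small p : p \in P -> y <= p%:R -> 4 * local_density R (L p) <= (size B)%:R^-1.
  move=> pP yp; have := card_lt data pP; rewrite -(ltr_nat R) => lp.
  apply: (@density_small R M c) => //.
  - by rewrite ler1n prime_gt0// (P_prime data pP).
  - by rewrite /c; lra.
  - by lra.
  - exact: lamM (set_mem pP).
have le2 p : p \in P -> y <= p%:R -> local_density R (L p) <= 2.
  move=> pP yp; have := small p pP yp.
  have : (size B)%:R^-1 <= 1 :> R by rewrite invf_le1 ?ltr0n// ler1n.
  lra.
pose Z := (Num.truncn (y + z)).+1.
have yzZ : y + z < Z%:R by exact: truncnS_gt.
have yZ : y <= Z%:R by lra.
have zZ : z <= Z%:R by lra.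
pose m := (Num.truncn N).+1.
have mN : m%:R <= 2 * N.
  have /andP[h _] := truncn_itv (ltW N0); rewrite /m -natr1; lra.
have bound i : sifted_set P L z N i -> (i < m)%N.
  by move=> [_ iN _]; rewrite -(ltr_nat R) (le_lt_trans iN)// truncnS_gt.
have eqS (F : nat -> R[i]) : \sum_(n \in sifted_set P L z N) F n =
    \sum_(n < m | (n : nat) \in sifted_set P L z N) F n.
  exact: fsbig_bounded.
have eqA (F : nat -> R) : \sum_(n \in sifted_set P L z N) F n =
    \sum_(n < m | (n : nat) \in sifted_set P L z N) F n.
  exact: fsbig_bounded.
have main := @sifted_large_sieve R P L y z N Z data z1 z4N le2 (circle R) B
  (fun b => repr b) delta m a isT mN (fset_uniq B) d0 sB0 (well_spaced_repr spB) small.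
rewrite eqA; under eq_bigr => b _.
  rewrite eqS; under eq_bigr do rewrite circle_e_repr.
  over.
apply: (le_trans main); set A := \sum_(n < m | _) _.
have A0 : 0 <= A by apply: sumr_ge0 => n _; exact: sqr_ge0.
rewrite ler_wpM2r//.
have W1 := weight_sum_ge1 y Z data z1.
have GVW := sieve_G_le data z1 le2 zZ yZ.
have G0 := sieve_G_gt0 data z1.
set W := weight_sum _ _ in W1 GVW *; set G := sieve_G _ _ _ in GVW G0 *.
have VK : sieve_V P L y <= T * C `^ kappa * ln (2 * beta) `^ kappa.
  apply: (le_trans (VT _ y2)); rewrite -mulrA; apply: (ler_wpM2l (ltW hT)).
  have lnb : 0 <= ln (2 * beta) by rewrite ln_ge0//; lra.
  have lny : 0 <= ln y by rewrite ln_ge0//; lra.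
  have C0 : 0 <= C.
    rewrite mulr_ge0// addr_ge0// divr_ge0// ln_ge0//; lra.
  have CL : 0 <= C * ln (2 * beta) by exact: mulr_ge0.
  rewrite -powRM// ge0_ler_powR ?nnegrE//; first exact: ltW.
  exact: (ln_level_le c2 b1).
have W0 : 0 < W by lra.
have D0 : 0 < N + delta^-1 by rewrite addr_gt0// invr_gt0.
rewrite ler_pdivrMr//.
have -> : 180 * T * C `^ kappa * ((N + delta^-1) / G) * ln (2 * #|` B|%:R) `^ kappa * W
  = 60 * (N + delta^-1) * ((3 * (T * C `^ kappa * ln (2 * beta) `^ kappa) * W) / G).
  by rewrite /beta; field; rewrite !gt_eqF.
rewrite ler_peMr ?mulr_ge0 ?(ltW D0)// ler_pdivlMr// mul1r.
apply: (le_trans GVW); rewrite ler_wpM2r ?(ltW W0)//.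
by rewrite ler_wpM2l.
Qed.
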